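(* Let $k\ge 3$ and $s\ge k+3$ be integers, and let $\eta$ be a positive number. Then there exists a positive number $\gamma$ such that for all $A\ge 1$, $$\#\{\mathbf a\in(\mathbb Z\setminus\{0\})^s:\ |\mathbf a|\le A,\ 0<\mathfrak S_{\mathbf a}<A^{-\eta}\}\ll A^{s-\gamma}.$$
   Context: For $\mathbf x\in\mathbb R^s$ write $|\mathbf x|=\max_j|x_j|$. For $\mathbf a=(a_1,\dots,a_s)\in(\mathbb Z\setminus\{0\})^s$ and a prime $p$, let $\chi_p(\mathbf a)=\lim_{h\to\infty}p^{h(1-s)}\#\{1\le x_j\le p^h\ (1\le j\le s): a_1x_1^k+\dots+a_sx_s^k\equiv 0\bmod p^h\}$, and $\mathfrak S_{\mathbf a}=\prod_p\chi_p(\mathbf a)$ (the limits exist and the product converges for $s\ge k+2$). The implicit constant depends on $k,s,\eta$. *)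

(* Defs.v *)
From HB Require Import structures.
From mathcomp Require Import all_boot all_order all_algebra finmap.
From mathcomp Require Import all_classical all_reals all_analysis.

Set Implicit Arguments.
Unset Strict Implicit.
Unset Printing Implicit Defensive.

Import Order.TTheory GRing.Theory Num.Theory.
Import numFieldNormedType.Exports.

Local Open Scope classical_set_scope.
Local Open Scope ring_scope.

Definition supnorm (R : realType) (s : nat) (x : 'I_s -> R) : R :=
  \big[Num.max/0]_(j < s) `|x j|.

(* The 'I_(p ^ h).+1 coordinates range over 0..p^h; the clause 1 <= x j
   leaves 1 <= x_j <= p^h. *)
Definition local_solutions (k s : nat) (a : {ffun 'I_s -> int}) (p h : nat) :
    {set {ffun 'I_s -> 'I_(p ^ h).+1}} :=
  [set x : {ffun 'I_s -> 'I_(p ^ h).+1} |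
     [forall j, (1 <= x j)%N] &&
     ((p ^ h)%N%:Z %| \sum_(j < s) a j * (x j : nat)%:Z ^+ k)%Z].

Definition chi (R : realType) (k s : nat) (a : {ffun 'I_s -> int}) (p : nat) : R :=
  limn (fun h : nat =>
    p%:R ^ (h%:Z * (1 - s%:Z)) * #|local_solutions k a p h|%:R : R).

(* The product over all primes is the limit, in increasing order of p, of the
   finite products; all limits taken here exist when s >= k + 2 and every a j
   is nonzero, so limn never returns its default value in that range. *)
Definition singular_series (R : realType) (k s : nat)
    (a : {ffun 'I_s -> int}) : R :=
  limn (fun n : nat => \prod_(0 <= p < n | prime p) chi R k a p : R).

Definition exceptional_set (R : realType) (k s : nat) (eta A : R) :
    set {ffun 'I_s -> int} :=
  [set a : {ffun 'I_s -> int} | [/\ forall j, a j != 0,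
               supnorm (fun j => (a j)%:~R : R) <= A
             & 0 < singular_series R k a < A `^ (- eta)]].

(* fset_set sends an infinite set to the empty one, so this finiteness is what
   makes #|` fset_set (exceptional_set _ _ _ _)| the genuine cardinality. *)
Lemma finite_exceptional_set (R : realType) (k s : nat) (eta A : R) :
  finite_set (@exceptional_set R k s eta A).
Proof.
pose N := Num.truncn A.
pose g (b : {ffun 'I_s -> 'I_(N + N).+1}) : {ffun 'I_s -> int} :=
  [ffun j => (b j : nat)%:Z - N%:Z].
apply: (@sub_finite_set _ _ (g @` setT)); last first.
  by apply: finite_image; exact: finite_finset.
move=> a [_ aA _].
have aN j : (`|a j| <= N)%N.
  rewrite -(ler_nat R) /N.
  have aj : `|a j|%N%:R <= A.
    apply: le_trans aA; rewrite /supnorm (bigD1 j)//= le_max.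
    by rewrite -intr_norm -abszE -pmulrn lexx.
  have A0 : 0 <= A by apply: le_trans aj.
  by rewrite ler_nat truncn_ge_nat.
have aN' j : - N%:Z <= a j <= N%:Z by rewrite -ler_norml -abszE lez_nat.
exists [ffun j => inord (absz (a j + N%:Z))] => //.
apply/ffunP => j; rewrite !ffunE; have /andP[l u] := aN' j.
have p : 0 <= a j + N%:Z by rewrite -lerBlDr sub0r.
rewrite inordK; first by rewrite gez0_abs// addrK.
by rewrite ltnS -lez_nat gez0_abs// PoszD lerD2r.
Qed.

(* Main.v *)
Require Import Defs.
From HB Require Import structures.
From mathcomp Require Import all_boot all_order all_algebra finmap.
From mathcomp Require Import all_classical all_reals all_analysis.
From mathcomp Require Import zify ring lra.

(** Write [B] for a small power of [A].  Outside a set of [O(A ^ s / B)] vectors,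
    no two coefficients have a common divisor exceeding [B] and no coefficient
    has a square divisor [w ^ 2] with [w > B].  For the remaining [a] with
    positive singular series the product of the local densities is at least a
    fixed power of [1 / B]:

    - If [p] is large and divides at most one coefficient, Hensel's lemma
      reduces [chi_p] to the number [N] of nonsingular zeros over the field with
      [p] elements.  The zero count is constant when the coefficients are
      multiplied by [k]-th powers, so its second moment over all coefficient
      vectors, which is computed by pairwise independence, bounds it at each
      individual vector.  This gives [chi_p >= 1 - O(p ^ (-3/2))] without
      exponential sums, and the product over these primes exceeds [1/2].

    - For every other prime, positivity of [chi_p] forces a primitive solution
      modulo any power of [p]: otherwise dividing out [p] shows that the
      densities satisfy [u_(h+k) <= u_h / p], whence [chi_p = 0].  Lifting one
      primitive solution gives [chi_p >= p ^ (- (2 v + 1) (s - 1))], where [v]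
      is the [p]-adic valuation of the product of the [k a_j].  These primes are
      small or divide some [gcd (a_i, a_j)], and the square condition controls
      their exponents in the [a_j], so their total contribution is a power of
      [1 / B]. *)

Set Implicit Arguments.
Unset Strict Implicit.
Unset Printing Implicit Defensive.

Import Order.TTheory GRing.Theory Num.Theory.
Import numFieldNormedType.Exports.

Local Open Scope ring_scope.

(** * Second moment of the zero count of diagonal equations over a finite field *)

Section FiniteFieldSecondMoment.
Variables (F : finFieldType) (t k : nat).
Local Notation q := #|F|.
Local Notation V := {ffun 'I_t -> F}.

Definition dotf (a u : V) : F := \sum_i a i * u i.
Definition powf (x : V) : V := [ffun i => x i ^+ k].
Definition diag_zeros (a : V) : {set V} := [set x | dotf a (powf x) == 0].

(** The indicator of zero, scaled and centred to have sum zero: it is the sum of the nontrivial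
    additive characters of [F], and stands in for exponential sums. *)
Definition ind0 (z : F) : int := q%:Z * (z == 0)%:Z - 1.
Definition corr (u v : V) : int := \sum_(a : V) ind0 (dotf a u) * ind0 (dotf a v).

Lemma dotfDl (a b u : V) : dotf (a + b) u = dotf a u + dotf b u.
Proof. by rewrite /dotf -big_split; apply: eq_bigr => i _; rewrite ffunE mulrDl. Qed.

Lemma dotfZl (c : F) (b u : V) : dotf [ffun i => c * b i] u = c * dotf b u.
Proof. by rewrite /dotf mulr_sumr; apply: eq_bigr => i _; rewrite ffunE mulrA. Qed.

Lemma dotfZr (c : F) (b u : V) : dotf b [ffun i => c * u i] = c * dotf b u.
Proof.
by rewrite /dotf mulr_sumr; apply: eq_bigr => i _; rewrite ffunE mulrCA.
Qed.

Lemma sum_eq0_indicator : \sum_(z : F) (z == 0)%:Z = 1.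
Proof.
rewrite (bigD1 0) //= eqxx big1 ?addr0 // => z /negbTE -> //.
Qed.

Lemma sum_ind0 : \sum_(z : F) ind0 z = 0.
Proof.
rewrite /ind0 sumrB -mulr_sumr sum_eq0_indicator mulr1 sumr_const.
by rewrite -mulr_natr mul1r natz subrr.
Qed.

Lemma sum_ind0_sqr : \sum_(z : F) ind0 z ^+ 2 = q%:Z ^+ 2 - q%:Z.
Proof.
have -> : \sum_(z : F) ind0 z ^+ 2 =
   \sum_(z : F) ((q%:Z ^+ 2 - 2 * q%:Z) * (z == 0)%:Z + 1).
  by apply: eq_bigr => z _; rewrite /ind0; case: (z == 0) => /=; rewrite ?mulr0 ?mulr1; ring.
rewrite big_split /= -mulr_sumr sum_eq0_indicator sumr_const.
rewrite -mulr_natr mul1r natz; ring.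
Qed.

Lemma sum_ind0_shift (y : F) : \sum_(c : F) ind0 (y + c) = 0.
Proof.
by rewrite -[RHS]sum_ind0 [RHS](reindex_inj (addrI y)).
Qed.

(* Translating [a] along [b] leaves [a.u] fixed and makes [a.v] equidistributed. *)
Lemma corr_eq0 (u v b : V) : dotf b u = 0 -> dotf b v = 1 -> corr u v = 0.
Proof.
move=> bu bv.
have shift c : corr u v = \sum_(a : V) ind0 (dotf a u) * ind0 (dotf a v + c).
  rewrite /corr (reindex_inj (addIr [ffun i => c * b i])) /=.
  apply: eq_bigr => a _.
  by rewrite !dotfDl !dotfZl bu bv mulr0 mulr1 addr0.
have : q%:Z * corr u v = 0.
  have -> : q%:Z * corr u v = \sum_(c : F) corr u v.
    by rewrite sumr_const -mulr_natl natz.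
  rewrite (eq_bigr _ (fun c _ => shift c)) exchange_big big1 //= => a _.
  by rewrite -mulr_sumr sum_ind0_shift mulr0.
move/eqP; rewrite mulf_eq0 => /orP[|/eqP //].
by rewrite eqz_nat -leqn0 leqNgt; move/negP; case; apply/card_gt0P; exists 0.
Qed.

Lemma card_ffun_ord : #|{: V}| = (q ^ t)%N.
Proof. by rewrite card_ffun card_ord. Qed.

Lemma dotf_delta (i : 'I_t) (c : F) (u : V) :
  dotf [ffun j => if j == i then c else 0] u = c * u i.
Proof.
rewrite /dotf (bigD1 i) //= ffunE eqxx big1 ?addr0 // => j /negbTE ji.
by rewrite ffunE ji mul0r.
Qed.

Lemma dotf0 (a : V) : dotf a 0 = 0.
Proof. by rewrite /dotf big1 // => i _; rewrite ffunE mulr0. Qed.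

Lemma corrC (u v : V) : corr u v = corr v u.
Proof. by apply: eq_bigr => a _; rewrite mulrC. Qed.

Lemma ffun_neq0 (u : V) : u != 0 -> exists i, u i != 0.
Proof.
move=> u0; apply/existsP; apply: contraNT u0 => /existsPn H; apply/eqP/ffunP => i.
by rewrite ffunE; apply/eqP; rewrite -[_ == _]negbK; apply: H.
Qed.

Lemma dotf_unit (u : V) : u != 0 -> exists b, dotf b u = 1.
Proof.
move=> u0; have [i ui] := ffun_neq0 u0.
by exists [ffun j => if j == i then (u i)^-1 else 0]; rewrite dotf_delta mulVf.
Qed.

(** Shifting [a] along [b] with [dotf b u = 1] equidistributes [dotf a u], so averaging over shifts
    turns each term into [sum_ind0_sqr]. *)
Lemma corr_self (u : V) : u != 0 -> corr u u = (q ^ t)%:Z * (q%:Z - 1).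
Proof.
case/dotf_unit => b bu.
have shift c : corr u u = \sum_(a : V) ind0 (dotf a u + c) ^+ 2.
  rewrite /corr (reindex_inj (addIr [ffun i => c * b i])) /=.
  apply: eq_bigr => a _.
  by rewrite !dotfDl !dotfZl bu mulr1 expr2.
have q0 : q%:Z != 0.
  by rewrite eqz_nat -lt0n; apply/card_gt0P; exists 0.
apply: (mulfI q0).
have -> : q%:Z * corr u u = \sum_(c : F) corr u u.
  by rewrite sumr_const -mulr_natl natz.
rewrite (eq_bigr _ (fun c _ => shift c)) exchange_big /=.
rewrite (eq_bigr (fun _ => q%:Z ^+ 2 - q%:Z)); last first.
  move=> a _; rewrite -sum_ind0_sqr.
  by rewrite [RHS](reindex_inj (addrI (dotf a u))).
rewrite sumr_const -mulr_natl natz card_ffun_ord; ring.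
Qed.

Lemma corr_scale (c : F) (u : V) : c != 0 -> corr u [ffun i => c * u i] = corr u u.
Proof.
move=> c0; apply: eq_bigr => a _; congr (_ * _).
by rewrite dotfZr /ind0 mulf_eq0 (negbTE c0).
Qed.

(** A nonvanishing 2 by 2 minor of [u] and [v] yields [b], supported on two coordinates; by
    [corr_eq0], non-proportional vectors are then uncorrelated. *)
Lemma nonproportional_separated (u v : V) : u != 0 ->
  (forall c : F, v != [ffun i => c * u i]) ->
  exists2 b, dotf b u = 0 & dotf b v = 1.
Proof.
move=> u0 npr.
have [i ui] := ffun_neq0 u0.
have [j vj] : exists j, v j != v i / u i * u j.
  apply/existsP; apply: contraNT (npr (v i / u i)) => /existsPn H.
  by apply/eqP/ffunP => j; rewrite ffunE; apply/eqP; rewrite -[_ == _]negbK; apply: H.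
set d := v j - v i / u i * u j.
have d0 : d != 0 by rewrite subr_eq0.
exists ([ffun l => if l == j then d^-1 else 0]
        + [ffun l => if l == i then - (u j / u i) / d else 0]).
  rewrite dotfDl !dotf_delta; field.
  by rewrite ui d0.
rewrite dotfDl !dotf_delta.
have -> : d^-1 * v j + - (u j / u i) / d * v i = d^-1 * d by rewrite /d; ring.
by rewrite mulVf.
Qed.

(** Counting scalars instead of testing proportionality lets the bound be summed over [v] by
    exchanging two sums. It also covers [u = v = 0], where every [c] counts. *)
Lemma corr_le (u v : V) :
  corr u v <= (q ^ t.+1)%:Z * #|[set c : F | v == [ffun i => c * u i]]|%:Z.
Proof.
have q0 : (0 < q)%N by apply/card_gt0P; exists 0.
have [->|u0] := eqVneq u 0.
  have [->|v0] := eqVneq v 0; last first.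
    have [b bv] := dotf_unit v0.
    by rewrite (corr_eq0 (dotf0 b) bv).
  have -> : [set c : F | 0 == [ffun i => c * (0 : V) i]] = [set: F].
    apply/setP => c; rewrite !inE; apply/eqP/ffunP => i.
    by rewrite !ffunE mulr0.
  rewrite cardsT /corr (eq_bigr (fun _ => (q%:Z - 1) ^+ 2)); last first.
    by move=> a _; rewrite dotf0 /ind0 eqxx mulr1 expr2.
  rewrite sumr_const -mulr_natl natz card_ffun_ord.
  rewrite expnS mulnC PoszM -mulrA ler_wpM2l //.
  by move: q0; move: #|F| => n n0; rewrite expr2; nia.
have [/existsP[c /eqP vE]|/existsPn npr] :=
  boolP [exists c : F, v == [ffun i => c * u i]]; last first.
  have [b bu bv] := nonproportional_separated u0 npr.
  by rewrite (corr_eq0 bu bv).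
have [c0|c0] := eqVneq c 0.
  have v0 : v = 0 by rewrite vE c0; apply/ffunP => i; rewrite !ffunE mul0r.
  have [b bu] := dotf_unit u0.
  by rewrite corrC v0 (corr_eq0 (dotf0 b) bu).
have c1 : (0 < #|[set c : F | v == [ffun i => (c * u i)%R]]|)%N.
  by apply/card_gt0P; exists c; rewrite inE vE.
rewrite {1}vE corr_scale // corr_self // expnS mulnC PoszM -mulrA ler_wpM2l //.
by move: q0 c1; move: #|F| #|_| => n m n0 m0; nia.
Qed.

Hypothesis k0 : (0 < k)%N.

Lemma card_kth_roots (b : F) : (#|[set z : F | z ^+ k == b]%R| <= k)%N.
Proof.
have p0 : 'X^k - b%:P != 0 :> {poly F}.
  by rewrite -size_poly_eq0 size_XnsubC.
have := @max_poly_roots _ _ (enum [set z : F | z ^+ k == b]) p0.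
rewrite size_XnsubC // ltnS -cardE; apply; last exact: enum_uniq.
apply/allP => z; rewrite mem_enum inE => /eqP zb.
by rewrite /root !hornerE zb subrr.
Qed.

Lemma card_powf_fiber (v : V) : (#|[set y : V | powf y == v]| <= k ^ t)%N.
Proof.
have -> : [set y : V | powf y == v] =
    [set y in family (fun i => mem [set z : F | z ^+ k == v i])].
  apply/setP => y; rewrite !inE; apply/eqP/familyP => [<- i|H].
    by rewrite !inE ffunE.
  by apply/ffunP => i; have := H i; rewrite !inE ffunE => /eqP.
rewrite cardsE card_family.
rewrite foldrE big_map big_enum /=.
apply: leq_trans (_ : \prod_(i < t) k <= _)%N; last by rewrite prod_nat_const card_ord.
by apply: leq_prod => i _; apply: card_kth_roots.
Qed.

(** The zero count minus its expected value [q ^ (t - 1)], multiplied by [q] to stay integral even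
    for [t = 0]. *)
Definition deviation (a : V) : int := q%:Z * #|diag_zeros a|%:Z - (q ^ t)%:Z.

Lemma deviationE (a : V) : deviation a = \sum_(x : V) ind0 (dotf a (powf x)).
Proof.
rewrite /ind0 sumrB -mulr_sumr sumr_const -mulr_natl mulr1 natz card_ffun_ord.
congr (_ * _ - _); rewrite -sum1_card big_mkcond /= (big_morph Posz PoszD erefl).
by apply: eq_bigr => x _; rewrite inE; case: (_ == _).
Qed.

(** Expanding the square leaves correlations of pairs of [k]-th power vectors. For given [x] and [c]
    at most [k ^ t] vectors [y] have [powf y = c * powf x], so few pairs are correlated. *)
Lemma sum_deviation_sqr :
  \sum_(a : V) deviation a ^+ 2 <= (k ^ t * q ^ (2 * t + 2))%:Z.
Proof.
have -> : \sum_(a : V) deviation a ^+ 2 =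
    \sum_(x : V) \sum_(y : V) corr (powf x) (powf y).
  transitivity (\sum_(a : V) \sum_(x : V) \sum_(y : V)
      ind0 (dotf a (powf x)) * ind0 (dotf a (powf y))).
    apply: eq_bigr => a _; rewrite deviationE expr2 mulr_suml.
    by apply: eq_bigr => x _; rewrite mulr_sumr.
  rewrite exchange_big /=; apply: eq_bigr => x _.
  by rewrite exchange_big.
have row x : \sum_(y : V) corr (powf x) (powf y)
    <= (q ^ t.+1)%:Z * (q * k ^ t)%:Z.
  apply: le_trans (ler_sum _ (fun y _ => corr_le (powf x) (powf y))) _.
  rewrite -mulr_sumr ler_wpM2l //.
  rewrite -(big_morph Posz PoszD erefl) lez_nat.
  rewrite (eq_bigr (fun y : V => \sum_(c : F) (powf y == [ffun i => (c * powf x i)%R]))%N);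
    last first.
    move=> y _; rewrite -sum1_card big_mkcond /=; apply: eq_bigr => c _.
    by rewrite inE; case: (_ == _).
  rewrite exchange_big /=.
  apply: leq_trans (_ : \sum_(c : F) k ^ t <= _)%N; last by rewrite sum_nat_const.
  apply: leq_sum => c _.
  apply: leq_trans (card_powf_fiber [ffun i => c * powf x i]).
  rewrite -sum1_card [X in (_ <= X)%N]big_mkcond /=; apply: leq_sum => y _.
  by rewrite inE; case: (_ == _).
apply: le_trans (ler_sum _ (fun x _ => row x)) _.
rewrite sumr_const -mulr_natl natz card_ffun_ord -!PoszM lez_nat.
rewrite eq_leq // expnS [(2 * t + 2)%N](_ : _ = (t + t + 1 + 1)%N); last by lia.
rewrite !expnD !expn1; ring.
Qed.

Lemma deviation_scale (a c : V) : (forall i, c i != 0) ->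
  deviation [ffun i => a i * c i ^+ k] = deviation a.
Proof.
move=> c0; rewrite /deviation; congr (_ * Posz _ - _).
pose f (x : V) : V := [ffun i => c i * x i].
have finj : injective f.
  move=> x y /ffunP H; apply/ffunP => i; have := H i.
  by rewrite !ffunE => /(mulfI (c0 i)).
have -> : diag_zeros [ffun i => a i * c i ^+ k] = f @^-1: diag_zeros a.
  apply/setP => x; rewrite !inE; congr (_ == _); apply: eq_bigr => i _.
  by rewrite !ffunE exprMn mulrA.
by rewrite on_card_preimset //; apply: onW_bij; apply: injF_bij.
Qed.

(* The zero count is constant on the orbit [a * c ^ k], which fills a positive
   proportion of the whole space: the mean square becomes a pointwise bound. *)
Lemma deviation_bound (a : V) : (forall i, a i != 0) ->
  (q.-1 ^ t)%:Z * deviation a ^+ 2 <= (k ^ (2 * t) * q ^ (2 * t + 2))%:Z.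
Proof.
move=> a0.
pose U : {set V} := [set c in family (fun _ : 'I_t => predC1 (0 : F))].
have UP (c : V) : reflect (forall i, c i != 0) (c \in U).
  by rewrite inE; apply: (iffP familyP) => H i; have := H i; rewrite !inE.
have cU : #|U| = (q.-1 ^ t)%N.
  rewrite /U cardsE card_family foldrE big_map big_enum /=.
  under eq_bigr do rewrite cardC1.
  by rewrite prod_nat_const card_ord.
pose f (c : V) : V := [ffun i => a i * c i ^+ k].
have -> : (q.-1 ^ t)%:Z * deviation a ^+ 2 = \sum_(c in U) deviation (f c) ^+ 2.
  rewrite (eq_bigr (fun _ => deviation a ^+ 2)); last first.
    by move=> c /UP c0; rewrite deviation_scale.
  by rewrite sumr_const -mulr_natl natz cU.
rewrite (partition_big f predT) //=.
apply: le_trans (_ : \sum_(b : V) (k ^ t)%:Z * deviation b ^+ 2 <= _); last first.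
  rewrite -mulr_sumr; apply: le_trans (ler_wpM2l _ sum_deviation_sqr) _ => //.
  by rewrite -PoszM lez_nat mulnA -expnD addnn -mul2n.
apply: ler_sum => b _.
rewrite (eq_bigr (fun _ => deviation b ^+ 2)); last by move=> c /andP[_ /eqP ->].
rewrite sumr_const -mulr_natl natz ler_wpM2r ?sqr_ge0 // lez_nat.
apply: leq_trans (card_powf_fiber [ffun i => b i / a i]).
apply: subset_leq_card; apply/fintype.subsetP => c; rewrite !inE.
move=> /andP[_ /eqP <-]; apply/eqP/ffunP => i.
by rewrite !ffunE mulrAC mulfV // mul1r.
Qed.

End FiniteFieldSecondMoment.

(** * Hensel lifting in one variable *)

Lemma exprD_second_order (R : comNzRingType) (x e : R) (n : nat) :
  exists r, (x + e) ^+ n = x ^+ n + n%:R * x ^+ n.-1 * e + e ^+ 2 * r.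
Proof.
elim: n => [|n [r IH]]; first by exists 0; rewrite !expr0; ring.
exists (n%:R * x ^+ n.-1 + r * x + e * r).
rewrite exprS IH; case: n IH => [|n] IH /=; first by rewrite !expr0 expr1; ring.
by rewrite !exprS -[n.+2%:R]natr1; ring.
Qed.

Lemma solve_linear_mod_prime (p : nat) (b u : int) : prime p -> ~~ (p%:Z %| u)%Z ->
  exists t : nat, (p%:Z %| b + u * t%:Z)%Z.
Proof.
move=> pp pu.
have cop : coprimez u p%:Z.
  by rewrite /coprimez gcdzC -[_ == _]/(coprime p `|u|) prime_coprime.
have /coprimezP[[v w] /= vw] := cop.
have p0 : p%:Z != 0 by rewrite eqz_nat -lt0n prime_gt0.
exists `|((- b * v) %% p%:Z)%Z|%N.
rewrite gez0_abs ?modz_ge0 //.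
have := divz_eq (- b * v) p%:Z; set y := (_ %/ _)%Z; set r := (_ %% _)%Z => E.
have -> : b + u * r = (b * w - u * y) * p%:Z.
  have -> : r = - b * v - y * p%:Z by rewrite E; ring.
  rewrite -{1}[b]mulr1 -vw; ring.
by rewrite dvdz_mull.
Qed.

(** Newton iteration on one variable, the other variables entering through the constant [c]. With
    [d] the valuation of [k * a], a correction [t * p ^ (H - d)] changes the linear term by a
    multiple of [p ^ H], and [2 * d < H] makes the quadratic term vanish modulo [p ^ (H + 1)]. *)
Lemma hensel_lift (p k : nat) (a c : int) (z0 h0 H : nat) :
  prime p -> (0 < k)%N -> a != 0 -> ~~ (p %| z0)%N ->
  (2 * logn p (k * `|a|) < h0)%N -> (h0 <= H)%N ->
  ((p ^ h0)%N%:Z %| a * z0%:Z ^+ k + c)%Z ->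
  exists2 z : nat, (z = z0 %[mod p])%N & ((p ^ H)%N%:Z %| a * z%:Z ^+ k + c)%Z.
Proof.
move=> pp k0 a0 pz0 dh hH hyp0.
have [d dE] : exists d, d = logn p (k * `|a|) by exists (logn p (k * `|a|)).
rewrite -dE in dh.
elim: H hH => [|H IH]; first by rewrite leqn0 => /eqP h00; rewrite h00 in dh.
rewrite leq_eqVlt => /orP[/eqP <-|]; first by exists z0.
rewrite ltnS => hH.
have d2 : (2 * d < H)%N := leq_trans dh hH.
have dH : (d <= H)%N by clear -d2; lia.
have dH2 : (H < 2 * (H - d))%N by clear -d2; lia.
have [z zz0 /dvdzP[b bE]] := IH hH.
have [u uE pu] : exists2 u : int, k%:Z * a = (p ^ d)%N%:Z * u & ~~ (p%:Z %| u)%Z.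
  have m0 : (0 < k * `|a|)%N by rewrite muln_gt0 k0 absz_gt0.
  have dv : ((p ^ d)%N%:Z %| k%:Z * a)%Z.
    by rewrite dvdzE abszM /= pfactor_dvdn // dE.
  have [u uE] := dvdzP dv; exists u; first by rewrite uE mulrC.
  apply/negP => /dvdzP[w wE].
  have : (p ^ d.+1 %| k * `|a|)%N.
    have -> : (k * `|a|)%N = absz (w * (p ^ d.+1)%N%:Z).
      have -> : (k * `|a|)%N = absz (k%:Z * a) by rewrite abszM.
      by rewrite uE wE expnS PoszM; congr absz; ring.
    by rewrite abszM /= dvdn_mull.
  by rewrite pfactor_dvdn // -dE ltnn.
have pz : ~~ (p%:Z %| u * z%:Z ^+ k.-1)%Z.
  rewrite dvdzE abszM Euclid_dvdM // negb_or pu abszX /= Euclid_dvdX //.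
  by rewrite negb_and; move: pz0; rewrite /dvdn zz0 => ->.
(* The current value is [b * p ^ H]; this [t] cancels [b] modulo [p]. *)
have [t tE] := solve_linear_mod_prime b pp pz.
exists (z + t * p ^ (H - d))%N.
  rewrite -modnDmr; have -> : (t * p ^ (H - d) %% p = 0)%N; last by rewrite addn0.
  have Hd : (0 < H - d)%N by clear -d2; lia.
  by apply/eqP/dvdn_mull/dvdn_exp.
rewrite PoszD.
have [r ->] := exprD_second_order z%:Z (t * p ^ (H - d))%N%:Z k.
set e := (t * _)%N.
have -> : a * (z%:Z ^+ k + k%:R * z%:Z ^+ k.-1 * e%:Z + e%:Z ^+ 2 * r) + c
  = (p ^ H)%N%:Z * (b + u * z%:Z ^+ k.-1 * t%:Z) + a * r * e%:Z ^+ 2.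
  have -> : (p ^ H = p ^ d * p ^ (H - d))%N by rewrite -expnD subnKC.
  transitivity ((a * z%:Z ^+ k + c) + (k%:Z * a) * z%:Z ^+ k.-1 * e%:Z
       + a * r * e%:Z ^+ 2); first by rewrite natz; ring.
  rewrite bE uE /e.
  have -> : (p ^ H = p ^ d * p ^ (H - d))%N by rewrite -expnD subnKC.
  rewrite !PoszM; ring.
apply: rpredD.
  by rewrite expnSr PoszM dvdz_mul.
rewrite dvdz_mull // /e PoszM exprMn dvdz_mull //.
have -> : (p ^ (H - d))%N%:Z ^+ 2 = (p ^ (2 * (H - d)))%N%:Z.
  by rewrite expr2 -PoszM -expnD addnn mul2n.
by rewrite dvdzE /= dvdn_exp2l.
Qed.

(** * Counting solutions of a diagonal congruence modulo prime powers *)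

Definition ord_mod (q : nat) (q0 : (0 < q)%N) (n : nat) : 'I_q :=
  Ordinal (ltn_pmod n q0).

Section DiagonalForm.
Variables (k s : nat) (a : {ffun 'I_s -> int}).

Definition diag_form (x : 'I_s -> nat) : int := \sum_(j < s) a j * (x j)%:Z ^+ k.

Definition residue_solutions (q : nat) : {set {ffun 'I_s -> 'I_q}} :=
  [set x : {ffun 'I_s -> 'I_q} | (q%:Z %| diag_form (fun j => x j))%Z].

Lemma diag_form_mod (q : nat) (x y : 'I_s -> nat) :
  (forall j, (x j = y j %[mod q])%N) ->
  (q%:Z %| diag_form x)%Z = (q%:Z %| diag_form y)%Z.
Proof.
move=> xy; rewrite -[diag_form x](subrK (diag_form y)) rpredDl //.
rewrite /diag_form -sumrB; apply: rpred_sum => j _.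
rewrite -mulrBr dvdz_mull // subrXX dvdz_mulr // -eqz_mod_dvd.
by rewrite !modz_nat xy.
Qed.

Lemma diag_form_scale (c : nat) (x : 'I_s -> nat) :
  diag_form (fun j => c * x j)%N = c%:Z ^+ k * diag_form x.
Proof.
rewrite /diag_form mulr_sumr; apply: eq_bigr => j _.
by rewrite PoszM exprMn mulrCA.
Qed.

Lemma card_local_solutions (p h : nat) : (0 < p)%N ->
  #|local_solutions k a p h| = #|residue_solutions (p ^ h)|.
Proof.
move=> p0; rewrite /local_solutions.
have : (0 < p ^ h)%N by rewrite expn_gt0 p0.
move: (p ^ h)%N => q q0.
pose f (x : {ffun 'I_s -> 'I_q.+1}) : {ffun 'I_s -> 'I_q} :=
  [ffun j => ord_mod q0 (x j)].
set L := [set _ | _].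
have finj : {in L &, injective f}.
  move=> x y; rewrite !inE => /andP[/forallP x1 _] /andP[/forallP y1 _] /ffunP E.
  apply/ffunP => j; apply/val_inj; have := E j; rewrite !ffunE => /(congr1 val) /=.
  have := x1 j; have := y1 j; have := ltn_ord (x j); have := ltn_ord (y j).
  rewrite !ltnS => yq xq y0 x0.
  have red n : (0 < n <= q)%N -> (n %% q = if n == q then 0 else n)%N.
    by case: eqP => [-> _|/eqP nq /andP[_ nle]]; rewrite ?modnn // modn_small // ltn_neqAle nq.
  rewrite !red ?x0 ?y0 //; case: eqP => [->|_]; case: eqP => [->|_] // E0.
    by rewrite -E0 in y0.
  by rewrite E0 in x0.
rewrite -(card_in_imset finj); congr #|pred_of_set _|.
apply/setP => y; rewrite inE; apply/imsetP/idP => [[x]|yS].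
  rewrite inE => /andP[_ xS] ->.
  rewrite (@diag_form_mod _ _ (fun j => x j)) // => j.
  by rewrite ffunE /= modn_mod.
(* In the range [1..q] the residue [0] is represented by [q]. *)
pose x : {ffun 'I_s -> 'I_q.+1} :=
  [ffun j => inord (if y j == 0%N :> nat then q else y j)].
have xE j : x j = (if y j == 0%N :> nat then q else y j) :> nat.
  rewrite ffunE inordK //; case: ifP => // _; by rewrite ltnS ltnW.
exists x; last first.
  apply/ffunP => j; apply/val_inj; rewrite ffunE /= xE.
  by case: eqP => [->|_]; rewrite ?modnn // modn_small.
rewrite inE; apply/andP; split.
  by apply/forallP => j; rewrite xE; case: eqP => // /eqP; rewrite lt0n.
rewrite -[X in (_ %| X)%Z]/(diag_form (fun j => x j)).
rewrite (@diag_form_mod _ _ (fun j => y j)) // => j.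
by rewrite xE; case: eqP => // ->; rewrite modnn mod0n.
Qed.

(* If every solution is divisible by [p], dividing out [p] drops the modulus by
   [p ^ k] and leaves [p ^ (k - 1)] lifts per coordinate. *)
Lemma card_residue_descent (p h : nat) : prime p -> (0 < k <= h)%N ->
  (forall x : 'I_s -> nat, ((p ^ h)%N%:Z %| diag_form x)%Z -> forall j, (p %| x j)%N) ->
  (#|residue_solutions (p ^ h)| <=
   #|residue_solutions (p ^ (h - k))| * (p ^ k.-1) ^ s)%N.
Proof.
move=> pp /andP[k0 kh] nop.
have p0 := prime_gt0 pp.
have q0 n : (0 < p ^ n)%N by rewrite expn_gt0 p0.
(* The quotient of [x j] by [p] lies below [p ^ (h - k) * p ^ (k - 1)]; the components are its
   remainder and quotient by [p ^ (h - k)]. *)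
pose f (x : {ffun 'I_s -> 'I_(p ^ h)}) :
    {ffun 'I_s -> 'I_(p ^ (h - k))} * {ffun 'I_s -> 'I_(p ^ k.-1)} :=
  ([ffun j => ord_mod (q0 (h - k)%N) (x j %/ p)],
   [ffun j => ord_mod (q0 k.-1) (x j %/ p %/ p ^ (h - k))]).
have pS (x : {ffun 'I_s -> 'I_(p ^ h)}) j : x \in residue_solutions (p ^ h) ->
    (x j = p * (x j %/ p) :> nat)%N.
  by rewrite inE => /nop /(_ j) xj; rewrite mulnC divnK.
have finj : {in residue_solutions (p ^ h) &, injective f}.
  move=> x y xS yS [/ffunP E1 /ffunP E2]; apply/ffunP => j; apply/val_inj => /=.
  rewrite (pS x j xS) (pS y j yS); congr muln.
  move: (E1 j) (E2 j); rewrite !ffunE => /(congr1 val) /= e1 /(congr1 val) /=.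
  have b (z : {ffun 'I_s -> 'I_(p ^ h)}) : (z j %/ p %/ p ^ (h - k) < p ^ k.-1)%N.
    rewrite -divnMA ltn_divLR ?muln_gt0 ?p0 ?q0 // mulnA -expnSr -expnD.
    by rewrite prednK // subnKC.
  rewrite !modn_small // => e2.
  by rewrite (divn_eq (x j %/ p) (p ^ (h - k))) e1 e2 -divn_eq.
rewrite -(card_in_imset finj).
have -> : ((p ^ k.-1) ^ s = #|[set: {ffun 'I_s -> 'I_(p ^ k.-1)}]|)%N.
  by rewrite cardsT card_ffun !card_ord.
rewrite -cardsX; apply: subset_leq_card; apply/fintype.subsetP => _ /imsetP[x xS ->].
rewrite !inE andbT.
rewrite (@diag_form_mod _ _ (fun j => x j %/ p)%N); last first.
  by move=> j; rewrite ffunE /= modn_mod.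
have : ((p ^ h)%N%:Z %| diag_form (fun j => p * (x j %/ p))%N)%Z.
  move: (xS); rewrite inE (@diag_form_mod _ _ (fun j => p * (x j %/ p))%N) //.
  by move=> j; rewrite -pS.
rewrite diag_form_scale; move: (diag_form _) => D.
rewrite -{1}(subnKC kh) expnD PoszM.
have -> : (p ^ k)%N%:Z = p%:Z ^+ k by rewrite -!natz natrX.
by rewrite dvdz_mul2l // expf_neq0 // eqz_nat -lt0n.
Qed.

(* A factor [P = p ^ (H - h0)] is kept on the right: a solution together with the
   unused parameter at the coordinate [jj m] determines all the parameters. *)
Lemma card_residue_lift (p h0 H : nat) (T : finType) (M : {set T})
    (xs : T -> 'I_s -> nat) (jj : T -> 'I_s) :
  prime p -> (0 < k)%N -> (0 < h0 <= H)%N ->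
  (forall m, m \in M -> [/\ ((p ^ h0)%N%:Z %| diag_form (xs m))%Z,
     ~~ (p %| xs m (jj m))%N, a (jj m) != 0 &
     (2 * logn p (k * `|a (jj m)|) < h0)%N]) ->
  {in M &, forall m m', (forall i, (xs m i = xs m' i %[mod p])%N) -> m = m'} ->
  (#|M| * (p ^ (H - h0)) ^ s <= #|residue_solutions (p ^ H)| * p ^ (H - h0))%N.
Proof.
move=> pp k0 /andP[h00 hH] MP Minj.
have p0 := prime_gt0 pp.
set P := (p ^ (H - h0))%N.
have PE : (p ^ H = p ^ h0 * P)%N by rewrite /P -expnD subnKC.
have q0 : (0 < p ^ H)%N by rewrite expn_gt0 p0.
pose W := {ffun 'I_s -> 'I_P}.
(* Membership in [M] sits under the existential so that [choice] yields a function of all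
   parameters. *)
have lift (mw : T * W) : exists z : nat, mw.1 \in M ->
    (z = xs mw.1 (jj mw.1) %[mod p])%N /\
    ((p ^ H)%N%:Z %| diag_form (fun i => if i == jj mw.1 then z
                        else xs mw.1 i + p ^ h0 * mw.2 i)%N)%Z.
  case: mw => m w /=.
  have [mM|_] := boolP (m \in M); last by exists 0%N.
  have [xS px a0 dl] := MP m mM.
  pose c := \sum_(i < s | i != jj m) a i * (xs m i + p ^ h0 * w i)%N%:Z ^+ k.
  have formE z : diag_form (fun i => if i == jj m then z
        else xs m i + p ^ h0 * w i)%N = a (jj m) * z%:Z ^+ k + c.
    rewrite /diag_form (bigD1 (jj m)) //= eqxx; congr (_ + _).
    by apply: eq_bigr => i /negbTE ->.
  have [|z z1 z2] := @hensel_lift p k (a (jj m)) c (xs m (jj m)) h0 H pp k0 a0 px dl hH.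
    rewrite -formE (@diag_form_mod _ _ (xs m)) // => i.
    by case: eqP => [->//|_]; rewrite mulnC addnC modnMDl.
  by exists z => _; rewrite formE.
have [zz zzP] := choice lift.
pose sol (mw : T * W) (i : 'I_s) : nat :=
  (if i == jj mw.1 then zz mw else xs mw.1 i + p ^ h0 * mw.2 i)%N.
pose f (mw : T * W) : {ffun 'I_s -> 'I_(p ^ H)} * 'I_P :=
  ([ffun i => ord_mod q0 (sol mw i)], mw.2 (jj mw.1)).
have pH : (p %| p ^ H)%N by rewrite dvdn_exp // (leq_trans h00).
have ph0 : (p %| p ^ h0)%N by rewrite dvdn_exp.
have solmod mw i : mw.1 \in M -> (sol mw i = xs mw.1 i %[mod p])%N.
  move=> mM; rewrite /sol; case: eqP => [->|_]; first by have [] := zzP mw mM.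
  by rewrite -modnDmr (eqP (dvdn_mulr _ ph0)) addn0.
have finj : {in finset.setX M [set: W] &, injective f}.
  move=> [m w] [m' w']; rewrite !finset.in_setX !finset.in_setT !andbT => mM mM'.
  move=> [/ffunP E1 E2].
  have E i : (sol (m, w) i = sol (m', w') i %[mod p ^ H])%N.
    by have := E1 i; rewrite !ffunE => /(congr1 val).
  (* Reduction modulo [p] recovers [m]; the residues modulo [p ^ H] then recover the parameters off
     the coordinate [jj m], and [E2] supplies the last one. *)
  have mm : m = m'.
    apply: Minj => // i; rewrite -(solmod (m, w)) // -(solmod (m', w')) //.
    by rewrite -(modn_dvdm _ pH) E modn_dvdm.
  move: E E2; rewrite -mm /= => E E2; congr pair; apply/ffunP => i.
  have [->//|ij] := eqVneq i (jj m).
  have := E i; rewrite /sol /= (negbTE ij) => /eqP.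
  rewrite eqn_modDl PE -!muln_modr eqn_pmul2l ?expn_gt0 ?p0 //.
  by rewrite !modn_small // => /eqP /val_inj.
have -> : (P ^ s = #|[set: W]|)%N by rewrite cardsT card_ffun !card_ord.
rewrite -[X in (_ <= _ * X)%N]card_ord -[X in (_ <= _ * X)%N]cardsT.
rewrite -!cardsX -(card_in_imset finj); apply: subset_leq_card.
apply/fintype.subsetP => y /imsetP[[m w]].
rewrite !finset.in_setX !finset.in_setT !andbT => mM ->.
rewrite finset.in_setX finset.in_setT andbT inE (@diag_form_mod _ _ (sol (m, w))); last first.
  by move=> i; rewrite ffunE /= modn_mod.
by have [] := zzP (m, w) mM.
Qed.

End DiagonalForm.

(** * Nonsingular zeros over a finite field *)

Section Nonsingular.
Variables (R : realType) (F : finFieldType) (k : nat).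
Hypothesis k0 : (0 < k)%N.
Local Notation q := #|F|.

(** When the characteristic does not divide [k], [b i * x i != 0] makes the partial derivative
    [k * b i * x i ^ (k - 1)] nonzero, so that Hensel's lemma applies at coordinate [i]. *)
Definition nonsingular_zeros (t : nat) (b : {ffun 'I_t -> F}) :
    {set {ffun 'I_t -> F}} :=
  [set x in diag_zeros k b | [exists i, b i * x i != 0]].

Lemma card_diag_zeros_le (t : nat) (b : {ffun 'I_t -> F}) :
  (forall i, b i != 0) -> (#|diag_zeros k b| <= #|nonsingular_zeros b|.+1)%N.
Proof.
move=> b0; rewrite -add1n -(cards1 (0 : {ffun 'I_t -> F})).
apply: leq_trans (leq_card_setU _ _).
apply/subset_leq_card/fintype.subsetP => x xS; rewrite finset.in_setU finset.in_set1.
have [->//|x0] := eqVneq x 0; rewrite inE xS /=.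
apply: contraNT x0 => /existsPn H; apply/eqP/ffunP => i; rewrite ffunE.
by have := H i; rewrite negbK mulf_eq0 (negbTE (b0 i)) => /eqP.
Qed.

(** The variable with zero coefficient is free, whence the factor [q]. *)
Lemma card_nonsingular_zeros_lift (t : nat) (b : {ffun 'I_t.+1 -> F}) (j0 : 'I_t.+1) :
  b j0 = 0 ->
  (q * #|nonsingular_zeros [ffun i => b (lift j0 i)]| <= #|nonsingular_zeros b|)%N.
Proof.
move=> bj0; set N' := nonsingular_zeros _.
pose f (cy : F * {ffun 'I_t -> F}) : {ffun 'I_t.+1 -> F} :=
  [ffun i => if unlift j0 i is Some i' then cy.2 i' else cy.1].
have fj0 cy : f cy j0 = cy.1 by rewrite ffunE unlift_none.
have fl cy i : f cy (lift j0 i) = cy.2 i by rewrite ffunE liftK.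
have finj : injective f.
  move=> [c y] [c' y'] E; congr pair; first by rewrite -[c](fj0 (c, y)) E fj0.
  by apply/ffunP => i; rewrite -[y i](fl (c, y)) E fl.
rewrite -cardsT -cardsX -(card_imset _ finj); apply/subset_leq_card.
apply/fintype.subsetP => x /imsetP[[c y]].
rewrite finset.in_setX finset.in_setT /= !inE => /andP[y1 /existsP[i y2]] ->.
apply/andP; split; last by apply/existsP; exists (lift j0 i); rewrite fl; move: y2; rewrite ffunE.
suff -> : dotf b (powf k (f (c, y))) = dotf [ffun i0 => b (lift j0 i0)] (powf k y).
  exact: y1.
rewrite /dotf (bigD1_ord j0) //= bj0 mul0r add0r.
by apply: eq_bigr => l _; rewrite !ffunE liftK.
Qed.

(** [deviation_bound] with [q - 1 >= q / 2] gives a relative error [O(q ^ (-3/2))], since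
    [q ^ 5 <= q ^ t]; the [+ 1] in the numerator pays for the zero vector, the only singular
    zero. *)
Lemma nonsingular_density_full (t : nat) (b : {ffun 'I_t -> F}) :
  (5 <= t)%N -> (forall i, b i != 0) ->
  1 - ((2 * k%:R ^+ 2) ^+ t + 1) / (q%:R * Num.sqrt q%:R)
    <= #|nonsingular_zeros b|%:R / q%:R ^+ t.-1 :> R.
Proof.
move=> t5 b0.
have q2 : (1 < q)%N by apply: card_finNzRing_gt1.
have := deviation_bound k0 b0.
have le1 := card_diag_zeros_le b0.
rewrite /deviation.
move: #|diag_zeros k b| #|nonsingular_zeros b| le1 => N N' le1.
move: #|F| q2 => {}q q2 dev.
have q1 : (1 : R) < q%:R by rewrite ltr1n.
have {dev}: (q.-1%:R) ^+ t * (q%:R * N%:R - q%:R ^+ t) ^+ 2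
    <= k%:R ^+ (2 * t) * q%:R ^+ (2 * t + 2) :> R.
  move: dev; rewrite -(ler_int R).
  by rewrite !(rmorphM, rmorphB, rmorphXn) /= -?pmulrn.
move=> dev.
set Q : R := q%:R in q1 dev *.
have Q0 : 0 < Q by lra.
have Q1 : Q / 2 <= q.-1%:R.
  have -> : q.-1%:R = Q - 1 by rewrite /Q -[in RHS](prednK (ltnW q2)) -natr1 addrK.
  have : 2 <= Q by rewrite /Q ler_nat.
  by move=> ?; lra.
set c : R := (2 * k%:R ^+ 2) ^+ t.
set y := N%:R / Q ^+ t.-1.
have tE : t = t.-1.+1 by rewrite prednK // (leq_trans _ t5).
have yE : Q * N%:R - Q ^+ t = Q ^+ t * (y - 1).
  have Qt0 : Q ^+ t.-1 != 0 by rewrite expf_neq0 // gt_eqF.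
  have -> : Q ^+ t = Q * Q ^+ t.-1 by rewrite [in LHS]tE exprS.
  by rewrite /y; field.
have c1 : 1 <= c.
  apply: exprn_ege1; have : (1 : R) <= k%:R by rewrite ler1n.
  by move: (k%:R : R) => K K1; nra.
have key : Q ^+ 3 * (y - 1) ^+ 2 <= c.
  have : (Q / 2) ^+ t * (Q ^+ t * (y - 1)) ^+ 2 <= k%:R ^+ (2 * t) * Q ^+ (2 * t + 2).
    rewrite -yE; apply: le_trans dev; rewrite ler_wpM2r ?sqr_ge0 //.
    by rewrite lerXn2r ?nnegrE //; lra.
  have Qt : 0 < Q ^+ t by rewrite exprn_gt0.
  have two : 0 < (2 : R) ^+ t by rewrite exprn_gt0.
  have -> : (Q / 2) ^+ t * (Q ^+ t * (y - 1)) ^+ 2 =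
      Q ^+ t * Q ^+ t * (Q ^+ t * (y - 1) ^+ 2) / 2 ^+ t.
    by rewrite exprMn exprVn; ring.
  rewrite ler_pdivrMr //.
  have -> : k%:R ^+ (2 * t) * Q ^+ (2 * t + 2) * 2 ^+ t =
      Q ^+ t * Q ^+ t * (c * Q ^+ 2) :> R.
    have -> : (2 * t + 2 = t + t + 2)%N by rewrite mul2n addnn.
    by rewrite /c exprMn -exprM !exprD; ring.
  rewrite ler_pM2l ?mulr_gt0 // => H.
  have : Q ^+ 2 * (Q ^+ 3 * (y - 1) ^+ 2) <= Q ^+ 2 * c.
    apply: le_trans (_ : Q ^+ t * (y - 1) ^+ 2 <= _); last by rewrite [_ * c]mulrC.
    rewrite mulrA -exprD ler_wpM2r ?sqr_ge0 // ler_eXn2l //.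
  by rewrite ler_pM2l // exprn_gt0.
have r0 : 0 < Num.sqrt Q by rewrite sqrtr_gt0.
have rE : Num.sqrt Q ^+ 2 = Q by rewrite sqr_sqrtr // ltW.
move: (Num.sqrt Q) r0 rE => r r0 rE.
have r1 : 1 < r by nra.
have Qr0 : 0 < Q * r by rewrite mulr_gt0.
have yc : 1 - y <= c / (Q * r).
  rewrite ler_pdivlMr //.
  have : ((1 - y) * (Q * r)) ^+ 2 <= c ^+ 2.
    have -> : ((1 - y) * (Q * r)) ^+ 2 = Q ^+ 3 * (y - 1) ^+ 2.
      by rewrite !exprMn rE; ring.
    by nra.
  by move: ((1 - y) * _) => z; nra.
have small : (Q ^+ t.-1)^-1 <= (Q * r)^-1.
  rewrite lef_pV2 ?posrE ?exprn_gt0 //.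
  apply: le_trans (_ : Q ^+ 2 <= _); first by nra.
  rewrite ler_eXn2l //; move: t5; clear; lia.
have NN : N%:R - 1 <= N'%:R :> R by rewrite lerBlDr natr1 ler_nat.
apply: le_trans (_ : (N%:R - 1) / Q ^+ t.-1 <= _); last first.
  by rewrite ler_wpM2r // invr_ge0 exprn_ge0 // ltW.
rewrite mulrBl mul1r -/y mulrDl mul1r; lra.
Qed.

(** Removing the one coefficient that may vanish leaves at least five nonzero ones; hence
    [6 <= s]. *)
Lemma nonsingular_density (s : nat) (b : {ffun 'I_s -> F}) :
  (6 <= s)%N -> (forall i j, b i = 0 -> b j = 0 -> i = j) ->
  1 - ((2 * k%:R ^+ 2) ^+ s + 1) / (q%:R * Num.sqrt q%:R)
    <= #|nonsingular_zeros b|%:R / q%:R ^+ s.-1 :> R.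
Proof.
move=> s6 b1.
have [/existsP[j0 /eqP bj0]|/existsPn b0] := boolP [exists j, b j == 0]; last first.
  exact: nonsingular_density_full (ltnW s6) b0.
case: s s6 b b1 j0 bj0 => // t; rewrite ltnS => t5 b b1 j0 bj0.
have q0 : (0 < q%:R :> R) by rewrite ltr0n (ltn_trans _ (card_finNzRing_gt1 F)).
have b0 i : [ffun i => b (lift j0 i)] i != 0.
  rewrite ffunE; apply/eqP => bi; have := b1 _ _ bj0 bi.
  by move/eqP; rewrite (negbTE (neq_lift _ _)).
apply: le_trans (_ : #|nonsingular_zeros [ffun i => b (lift j0 i)]|%:R / q%:R ^+ t.-1 <= _).
  apply: le_trans (nonsingular_density_full t5 b0).
  rewrite lerD2l lerN2 ler_pM2r ?invr_gt0 ?mulr_gt0 ?sqrtr_gt0 // lerD2r.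
  have K1 : (1 : R) <= 2 * k%:R ^+ 2.
    have : (1 : R) <= k%:R by rewrite ler1n.
    by move: (k%:R : R) => K K1; nra.
  by rewrite [leRHS]exprS ler_peMl // exprn_ge0 // (le_trans ler01 K1).
have -> : q%:R ^+ t.+1.-1 = q%:R * q%:R ^+ t.-1 :> R.
  by rewrite -exprS prednK // (leq_trans _ t5).
rewrite invfM mulrA ler_pM2r ?invr_gt0 ?exprn_gt0 // ler_pdivlMr // mulrC -natrM ler_nat.
exact: card_nonsingular_zeros_lift.
Qed.

End Nonsingular.

(** * Lower bounds for the local density at one prime *)

Section LocalDensity.
Variables (R : realType) (k s : nat) (a : {ffun 'I_s -> int}).

Definition local_density (p h : nat) : R :=
  #|residue_solutions k a (p ^ h)|%:R / p%:R ^+ (h * s.-1).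

Hypothesis s0 : (0 < s)%N.

Lemma chiE (p : nat) : (0 < p)%N -> chi R k a p = limn (local_density p).
Proof.
move=> p0; rewrite /chi; congr (limn _); apply/funext => h.
rewrite card_local_solutions // /local_density mulrC; congr (_ * _).
have -> : h%:Z * (1 - s%:Z) = - (h * s.-1)%N%:Z.
  by rewrite -{1}(prednK s0) PoszM -[s.-1.+1]addn1 PoszD; ring.
by rewrite exprnN.
Qed.

(* [limn] of a divergent sequence is [0], so positivity forces convergence. *)
Lemma chi_cvg (p : nat) : (0 < p)%N -> 0 < chi R k a p ->
  (local_density p @ \oo --> chi R k a p)%classic.
Proof.
move=> p0 chi0; rewrite chiE //.
have [//|ncv] := pselect (cvgn (local_density p)).
by move: chi0; rewrite chiE // (dvgP ncv) ltxx.
Qed.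

Lemma local_density_ge0 p h : 0 <= local_density p h.
Proof. by rewrite mulr_ge0 // invr_ge0 exprn_ge0. Qed.

Lemma chi_ge (p h0 : nat) (c : R) : (0 < p)%N -> 0 < chi R k a p ->
  (forall h, (h0 <= h)%N -> c <= local_density p h) -> c <= chi R k a p.
Proof.
move=> p0 /(chi_cvg p0) cv H.
apply: (cvgr_to_ge cv); near=> h; apply: H; near: h; exact: nbhs_infty_ge.
Unshelve. all: by end_near. Qed.

Lemma local_density_lift (p h0 H : nat) (T : finType) (M : {set T})
    (xs : T -> 'I_s -> nat) (jj : T -> 'I_s) :
  prime p -> (0 < k)%N -> (0 < h0 <= H)%N ->
  (forall m, m \in M -> [/\ ((p ^ h0)%N%:Z %| diag_form k a (xs m))%Z,
     ~~ (p %| xs m (jj m))%N, a (jj m) != 0 &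
     (2 * logn p (k * `|a (jj m)|) < h0)%N]) ->
  {in M &, forall m m', (forall i, (xs m i = xs m' i %[mod p])%N) -> m = m'} ->
  #|M|%:R / p%:R ^+ (h0 * s.-1) <= local_density p H.
Proof.
move=> pp k0 /andP[h00 hH] MP Minj.
have p0 := prime_gt0 pp.
have p0R : 0 < p%:R :> R by rewrite ltr0n.
have le1 : (#|M| * p ^ ((H - h0) * s.-1) <= #|residue_solutions k a (p ^ H)|)%N.
  rewrite -(@leq_pmul2r (p ^ (H - h0))) ?expn_gt0 ?p0 //.
  have := card_residue_lift pp k0 (introT andP (conj h00 hH)) MP Minj.
  by rewrite -{1}(prednK s0) expnS -expnM mulnA mulnAC.
rewrite /local_density.
have -> : (H * s.-1 = h0 * s.-1 + (H - h0) * s.-1)%N by rewrite -mulnDl subnKC.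
rewrite exprD invfM mulrA mulrAC ler_pM2r ?invr_gt0 ?exprn_gt0 //.
by rewrite ler_pdivlMr ?exprn_gt0 // -natrX -natrM ler_nat.
Qed.

(** There are [p ^ ((k - 1) * s)] lifts against a normalization [p ^ (k * (s - 1))], and the ratio
    [p ^ (k - s)] is at most [1 / p]. *)
Lemma local_density_descent (p h : nat) : prime p -> (0 < k < s)%N ->
  (forall x : 'I_s -> nat, ((p ^ (h + k))%N%:Z %| diag_form k a x)%Z ->
     forall j, (p %| x j)%N) ->
  p%:R * local_density p (h + k) <= local_density p h.
Proof.
move=> pp /andP[k0 ks] nop.
have p0 := prime_gt0 pp.
have p0R : 0 < p%:R :> R by rewrite ltr0n.
have := card_residue_descent pp (introT andP (conj k0 (leq_addl h k))) nop.
rewrite addnK -(ler_nat R) => le1.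
rewrite /local_density mulnDl exprD invfM [leLHS]mulrCA !mulrA mulrAC.
rewrite ler_pM2r ?invr_gt0 ?exprn_gt0 //.
rewrite ler_pdivrMr ?exprn_gt0 //.
apply: le_trans (ler_wpM2r (ltW p0R) le1) _.
rewrite natrM -mulrA ler_wpM2l // -expnM natrX -exprSr ler_weXn2l ?ler1n //.
move: k0 ks; clear; nia.
Qed.

Lemma chi_ge_nonzero_coefs (p : nat) : prime p -> (0 < k < s)%N ->
  (forall j, a j != 0) -> 0 < chi R k a p ->
  (p%:R ^+ ((2 * logn p (\prod_j (k * `|a j|))).+1 * s.-1))^-1 <= chi R k a p.
Proof.
move=> pp ks a0 chi0.
have p0 := prime_gt0 pp.
have /andP[k0 _] := ks.
(* The valuation of the whole product bounds that of each factor, so this [h0] suits Hensel's lemma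
   at any coordinate prime to [p]. *)
set h0 := (2 * _).+1.
have [[x [xS [j xj]]]|nop] := pselect (exists x : 'I_s -> nat,
    ((p ^ h0)%N%:Z %| diag_form k a x)%Z /\ exists j, ~~ (p %| x j)%N).
  apply: (@chi_ge p h0) => // h hh.
  have := @local_density_lift p h0 h unit [set: unit] (fun _ => x) (fun _ => j).
  rewrite cardsT card_unit mul1r; apply => //.
    move=> _ _; split => //; rewrite /h0 ltnS leq_mul2l /=.
    apply: dvdn_leq_log; last by rewrite (bigD1 j) //= dvdn_mulr.
    by apply: prodn_gt0 => i; rewrite muln_gt0 k0 absz_gt0 a0.
  by move=> [] [].
exfalso.
have cv := chi_cvg p0 chi0.
(* In the limit the descent gives [chi - p * chi >= 0], impossible for positive [chi]. *)
have cv2 : ((fun h => local_density p h - p%:R * local_density p (h + k)%N) @ \oo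
    --> chi R k a p - p%:R * chi R k a p)%classic.
  apply: cvgB => //; apply: cvgM; first exact: cvg_cst.
  by have := cv; rewrite -(cvg_shiftn k).
have : 0 <= chi R k a p - p%:R * chi R k a p.
  apply: (cvgr_to_ge cv2); near=> h; rewrite subr_ge0.
  apply: local_density_descent => // x xS j; apply/negP => /negP xj.
  apply: nop; exists x; split; last by exists j.
  apply: dvdz_trans xS; rewrite dvdzE /= dvdn_exp2l //.
  by rewrite (leq_trans _ (leq_addr _ _)) //; near: h; exact: nbhs_infty_ge.
have : (1 < p%:R :> R) by rewrite ltr1n prime_gt1.
by move: chi0; move: (chi R k a p) (p%:R) => X P; nra.
Unshelve. all: by end_near. Qed.

(** At a nonsingular coordinate [p] divides neither [k] nor the coefficient, so lifting starts from
    [h0 = 1] and every nonsingular zero modulo [p] contributes. *)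
Lemma chi_ge_coprime_coefs (p : nat) : prime p -> ~~ (p %| k)%N -> (6 <= s)%N ->
  (0 < k)%N ->
  (forall i j, (p%:Z %| a i)%Z -> (p%:Z %| a j)%Z -> i = j) ->
  0 < chi R k a p ->
  1 - ((2 * k%:R ^+ 2) ^+ s + 1) / (p%:R * Num.sqrt p%:R) <= chi R k a p.
Proof.
move=> pp pk s6 k0 a1 chi0.
have p0 := prime_gt0 pp.
pose F := 'F_p.
have Fp : #|{: F}| = p by rewrite card_Fp.
pose b : {ffun 'I_s -> F} := [ffun i => (a i)%:~R].
have pch : p \in [pchar F] := pchar_Fp pp.
have dvF (z : int) : (p%:Z %| z)%Z = (z%:~R == 0 :> F) by rewrite (dvdz_pcharf pch).
have b1 i j : b i = 0 -> b j = 0 -> i = j.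
  by rewrite !ffunE => /eqP bi /eqP bj; apply: a1; rewrite dvF.
have := @nonsingular_density R F k k0 s b s6 b1; rewrite Fp => le1.
apply: le_trans le1 _.
apply: (@chi_ge p 1) => // h h1.
have j0 : 'I_s := Ordinal (leq_trans (ltn0Sn 5) s6).
pose jj (x : {ffun 'I_s -> F}) := odflt j0 [pick i | b i * x i != 0].
have := @local_density_lift p 1 h _ (nonsingular_zeros k b)
   (fun x i => x i : nat) jj pp k0.
rewrite mul1n; apply.
- by [].
- move=> x; rewrite !inE => /andP[x1 x2].
  have bx : b (jj x) * x (jj x) != 0.
    rewrite /jj; case: pickP => [//|H]; case/existsP: x2 => i.
    by rewrite H.
  have valF (y : F) : (y : nat)%:R = y by rewrite natr_Zp.
  have xj : x (jj x) != 0 by apply: contraNneq bx => ->; rewrite mulr0.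
  have bj : b (jj x) != 0 by apply: contraNneq bx => ->; rewrite mul0r.
  have paj : ~~ (p %| `|a (jj x)|)%N.
    by have := dvF (a (jj x)); rewrite dvdzE /= => ->; move: bj; rewrite ffunE.
  split.
  + rewrite expn1 dvF /diag_form rmorph_sum /=; move: x1; congr (_ == _).
    apply: eq_bigr => i _; rewrite !ffunE rmorphM rmorphXn /=.
    by rewrite -pmulrn valF.
  + by rewrite (dvdn_pcharf pch) valF.
  + by apply: contraNneq paj => ->.
  + by rewrite lognE pp Euclid_dvdM // (negbTE pk) (negbTE paj) andbF.
- move=> x y _ _ xy; apply/ffunP => i; apply: val_inj => /=.
  have := xy i; rewrite !modn_small // -[X in (_ < X)%N]Fp card_ord; exact: ltn_ord.
Qed.

End LocalDensity.

(** * Products of factors [1 - O(n ^ (-3/2))] *)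

Section TailProduct.
Variable R : realType.

(** Comparison with the integral of [x ^ (-3/2)]; consecutive square roots satisfy
    [(y - x) * (x + y) = 1]. *)
Lemma inv_sqrt_telescope (n : nat) : (0 < n)%N ->
  (n.+1%:R * Num.sqrt n.+1%:R)^-1 <=
  2 * ((Num.sqrt n%:R)^-1 - (Num.sqrt n.+1%:R)^-1) :> R.
Proof.
move=> n0.
have x0 : 0 < Num.sqrt n%:R :> R by rewrite sqrtr_gt0 ltr0n.
have y0 : 0 < Num.sqrt n.+1%:R :> R by rewrite sqrtr_gt0 ltr0n.
have xE : Num.sqrt n%:R ^+ 2 = n%:R :> R by rewrite sqr_sqrtr.
have yE : Num.sqrt n.+1%:R ^+ 2 = n.+1%:R :> R by rewrite sqr_sqrtr.
have xy : Num.sqrt n.+1%:R ^+ 2 = Num.sqrt n%:R ^+ 2 + 1 :> R by rewrite xE yE natr1.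
rewrite -[X in (X * _)^-1]yE; move: (Num.sqrt n%:R) (Num.sqrt n.+1%:R) x0 y0 xy => x y x0 y0 xy.
have -> : 2 * (x^-1 - y^-1) = 2 * (y - x) / (x * y).
  by field; rewrite !gt_eqF.
rewrite ler_pdivlMr ?mulr_gt0 // mulrC ler_pdivrMr ?mulr_gt0 ?exprn_gt0 //.
have lexy : x <= y by nra.
have d : (y - x) * (x + y) = 1 by nra.
have : x * y * ((y - x) * (x + y)) <= 2 * (y - x) * (y ^+ 2 * y).
  have -> : x * y * ((y - x) * (x + y)) = (y - x) * (x * y * (x + y)) by ring.
  have -> : 2 * (y - x) * (y ^+ 2 * y) = (y - x) * (2 * (y ^+ 2 * y)) by ring.
  rewrite ler_wpM2l ?subr_ge0 //.
  have h1 : x * (x + y) <= y * (2 * y) by apply: ler_pM; nra.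
  have -> : x * y * (x + y) = y * (x * (x + y)) by ring.
  have -> : 2 * (y ^+ 2 * y) = y * (y * (2 * y)) by ring.
  by rewrite ler_wpM2l // ltW.
by rewrite d mulr1.
Qed.

Lemma tail_prod_ge_half (C : R) (n0 : nat) : 0 <= C -> (0 < n0)%N ->
  4 * C <= Num.sqrt n0%:R ->
  forall (P : pred nat) (f : nat -> R),
  (forall n, P n -> (n0 < n)%N /\ 1 - C / (n%:R * Num.sqrt n%:R) <= f n) ->
  forall N, 1 / 2 <= \prod_(0 <= n < N | P n) f n.
Proof.
move=> C0 n00 Cn P f Pf N.
pose g n : R := 2 * C / Num.sqrt n%:R.
have sq n : (0 < n)%N -> 0 < Num.sqrt n%:R :> R by move=> ?; rewrite sqrtr_gt0 ltr0n.
have g0 n : 0 <= g n by rewrite /g mulr_ge0 ?invr_ge0 ?sqrtr_ge0 ?mulr_ge0.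
have gh : g n0 <= 1 / 2 by rewrite /g ler_pdivrMr ?sq //; lra.
have gdec n : (n0 <= n)%N -> g n <= g n0.
  move=> hn; rewrite /g ler_wpM2l ?mulr_ge0 // lef_pV2 ?posrE ?sq //.
    by rewrite ler_sqrt // ler_nat.
  exact: leq_trans hn.
(* A telescoping bound that survives induction: it stays at most 1, so multiplying by [1 - e] lowers
   it by at most [e], which the drop of [g] absorbs. The [maxn] keeps it equal to 1 until the
   indices exceed [n0]. *)
suff : 1 - g n0 + g (maxn n0 N.-1) <= \prod_(0 <= n < N | P n) f n.
  by have := g0 (maxn n0 N.-1); move: gh => /[swap] ? /[swap] ?; lra.
elim: N => [|N IH]; first by rewrite big_geq // maxn0; lra.
rewrite big_mkcond big_nat_recr //= -big_mkcond /=.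
set X := 1 - g n0 + _ in IH.
have X1 : X <= 1 by have := gdec _ (leq_maxl n0 N.-1); rewrite /X; lra.
have X0 : 0 <= X by have := g0 (maxn n0 N.-1); rewrite /X; lra.
case: ifP => PN; last first.
  rewrite mulr1; apply: le_trans IH; rewrite /X lerD2l /g ler_wpM2l ?mulr_ge0 //.
  rewrite lef_pV2 ?posrE ?sq ?leq_max ?n00 //.
  rewrite ler_sqrt // ler_nat geq_max leq_maxl /= leq_max leq_pred orbT //.
have [n0N fN] := Pf N PN.
have NE : maxn n0 N.-1 = N.-1 by apply/maxn_idPr; rewrite -ltnS prednK // (leq_trans _ n0N).
have NE' : maxn n0 N = N by apply/maxn_idPr/ltnW.
have N1 : (0 < N.-1)%N by rewrite (leq_trans n00) // -NE leq_maxl.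
set e := C / _ in fN.
have le_e : e <= g N.-1 - g N.
  have := inv_sqrt_telescope N1; rewrite prednK ?(leq_trans _ n0N) // => T.
  apply: le_trans (ler_wpM2l C0 T) _.
  by rewrite le_eqVlt /g; apply/orP; left; apply/eqP; ring.
have gN := gdec N.-1 _; rewrite -NE leq_maxl NE in gN.
have e1 : e <= 1 / 2 by have := g0 N; have := gN isT; lra.
have e0 : 0 <= e by rewrite mulr_ge0 // invr_ge0 mulr_ge0 ?sqrtr_ge0.
apply: le_trans (_ : X * (1 - e) <= _); last first.
  by apply: ler_pM => //; lra.
rewrite NE'; rewrite /X NE in X0 X1 *.
have : X * e <= e by rewrite /X NE ler_piMl.
by rewrite /X NE mulrBr mulr1; lra.
Qed.

End TailProduct.

(** * Parts of an integer at a given set of primes *)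

Section PrimeParts.
Local Open Scope nat_scope.

Lemma prod_primes_logn (N m : nat) (pi : nat_pred) :
  \prod_(0 <= p < N | prime p && (p \in pi)) p ^ logn p m =
  \prod_(0 <= p < N | p \in pi) p ^ logn p m.
Proof.
rewrite [LHS]big_mkcond [RHS]big_mkcond /=; apply: eq_bigr => p _.
by case pp: (prime p) => //=; case: ifP => // _; rewrite lognE pp.
Qed.

Lemma prod_primes_logn_le (N m : nat) (pi : nat_pred) : 0 < m ->
  \prod_(0 <= p < N | prime p && (p \in pi)) p ^ logn p m <= m`_pi.
Proof.
move=> m0; rewrite (widen_partn pi (leq_maxr N m)).
set N' := maxn N m.
have NN' : N <= N'.+1 by rewrite leqW // leq_maxl.
rewrite (big_cat_nat (leq0n N) NN') /= -prod_primes_logn.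
by rewrite leq_pmulr // prodn_gt0 // => p; rewrite expn_gt0; case: p.
Qed.

Lemma prod_primes_le (N M : nat) : 0 < M ->
  \prod_(0 <= p < N | prime p && (p \in \pi(M))) p <= M.
Proof.
move=> M0.
apply: leq_trans (_ : \prod_(0 <= p < N | prime p && (p \in \pi(M))) p ^ logn p M <= _).
  apply: leq_prod => p /andP[pp pM].
  rewrite -{1}[p]expn1 leq_exp2l ?prime_gt1 // logn_gt0; exact: pM.
apply: leq_trans (prod_primes_logn_le _ _ M0) _.
by rewrite dvdn_leq // dvdn_part.
Qed.

(* Up to the radical of [M], the part of [n] at the primes of [M] is a
   square dividing [n]. *)
Lemma partn_le (M n B : nat) : 0 < M -> 0 < n ->
  (forall w, w * w %| n -> w <= B) -> n`_\pi(M) <= M * (B * B).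
Proof.
move=> M0 n0 wB.
set w := \prod_(0 <= p < n.+1 | prime p && (p \in \pi(M))) p ^ (logn p n)./2.
have parE : n`_\pi(M) =
    \prod_(0 <= p < n.+1 | prime p && (p \in \pi(M))) p ^ logn p n.
  by rewrite prod_primes_logn.
have wn : w * w %| n.
  apply: dvdn_trans (dvdn_part \pi(M) n); rewrite parE -big_split /=.
  apply: (big_ind2 (fun x y => x %| y)) => // [x1 x2 y1 y2|p _]; first exact: dvdn_mul.
  by rewrite -expnD dvdn_exp2l // addnn -[leqRHS]odd_double_half leq_addl.
apply: leq_trans (_ : M * (w * w) <= _); last by rewrite leq_mul2l leq_mul ?orbT ?wB.
apply: leq_trans (leq_mul (prod_primes_le n.+1 M0) (leqnn (w * w))).
rewrite parE -!big_split /=; apply: leq_prod => p /andP[pp _].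
rewrite -expnD -expnS leq_exp2l ?prime_gt1 // addnn -[leqLHS]odd_double_half.
by rewrite -add1n leq_add2r leq_b1.
Qed.

End PrimeParts.

(** * Positivity of the local factors *)

Section SingularSeries.
Variables (R : realType) (k s : nat) (a : {ffun 'I_s -> int}).
Hypothesis S0 : 0 < singular_series R k a.

Local Notation partial_prod n := (\prod_(0 <= p < n | prime p) chi R k a p).

Lemma singular_series_cvg :
  ((fun n => partial_prod n) @ \oo --> singular_series R k a)%classic.
Proof.
have [//|ncv] := pselect (cvgn (fun n => partial_prod n)).
by move: S0; rewrite /singular_series (dvgP ncv) ltxx.
Qed.

(** One zero factor annihilates all later partial products, and with them the limit. *)
Lemma chi_neq0 (p : nat) : prime p -> chi R k a p != 0.
Proof.
move=> pp; apply/negP => /eqP chi0.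
suff : singular_series R k a <= 0 by rewrite leNgt S0.
apply: (cvgr_to_le singular_series_cvg); near=> n.
rewrite (_ : partial_prod n = 0) //.
have pn : (p < n)%N by near: n; exact: nbhs_infty_gt.
by rewrite big_mkcond (bigD1_seq p) /= ?pp ?mem_index_iota ?iota_uniq // chi0 mul0r.
Unshelve. all: by end_near. Qed.

(** The densities are nonnegative, hence so is [chi], which is [0] by default if they diverge;
    [chi_neq0] makes this strict. *)
Lemma chi_gt0 (p : nat) : (0 < s)%N -> prime p -> 0 < chi R k a p.
Proof.
move=> s0 pp; rewrite lt_neqAle eq_sym chi_neq0 //=.
rewrite (chiE R k a s0 (prime_gt0 pp)).
have [cv|ncv] := pselect (cvgn (local_density R k a p)); last by rewrite (dvgP ncv).
by apply: (cvgr_to_ge cv); apply: nearW => n; exact: local_density_ge0.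
Qed.

End SingularSeries.

(** * Lower bound for the singular series *)

Section LowerBound.
Variables (R : realType) (k s : nat).
Hypotheses (k0 : (0 < k)%N) (ks : (k < s)%N) (s6 : (6 <= s)%N).

(** For nonzero coefficients, its prime factors are exactly the primes up to [n0] and those dividing
    two coefficients; its size controls products over them. *)
Definition bad_modulus (n0 : nat) (a : {ffun 'I_s -> int}) : nat :=
  (n0`! * \prod_i \prod_(j | j != i) gcdn `|a i| `|a j|)%N.

Lemma bad_modulus_gt0 n0 (a : {ffun 'I_s -> int}) :
  (forall j, a j != 0) -> (0 < bad_modulus n0 a)%N.
Proof.
move=> a0; rewrite muln_gt0 fact_gt0 /=; apply: prodn_gt0 => i; apply: prodn_gt0 => j.
by rewrite gcdn_gt0 absz_gt0 a0.
Qed.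

Lemma bad_modulus_le n0 (a : {ffun 'I_s -> int}) (B : nat) : (0 < B)%N ->
  (forall i j, i != j -> (gcdn `|a i| `|a j| <= B)%N) ->
  (bad_modulus n0 a <= n0`! * B ^ (s * s))%N.
Proof.
move=> B0 gB; rewrite leq_mul2l; apply/orP; right.
apply: leq_trans (_ : \prod_(i < s) B ^ s <= _)%N; last first.
  by rewrite prod_nat_const card_ord -expnM.
apply: leq_prod => i _.
apply: leq_trans (_ : \prod_(j < s) B <= _)%N; last by rewrite prod_nat_const card_ord.
rewrite big_mkcond; apply: leq_prod => j _; case: ifP => // ji.
by rewrite gB // eq_sym.
Qed.

Lemma good_prime n0 (a : {ffun 'I_s -> int}) p : prime p ->
  (forall j, a j != 0) -> p \notin \pi(bad_modulus n0 a) ->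
  (n0 < p)%N /\ forall i j, (p%:Z %| a i)%Z -> (p%:Z %| a j)%Z -> i = j.
Proof.
move=> pp a0; rewrite mem_primes pp bad_modulus_gt0 //= Euclid_dvdM // negb_or.
move=> /andP[pn pg]; split.
  by rewrite ltnNge; apply: contra pn => pn0; rewrite dvdn_fact // prime_gt0.
move=> i j; rewrite !dvdzE /= => pi pj.
apply/eqP; apply: contraNT pg => ij.
rewrite (bigD1 i) //= dvdn_mulr // (bigD1 j) 1?eq_sym //= dvdn_mulr //.
by rewrite dvdn_gcd pi pj.
Qed.

(* The primes dividing [bad_modulus] absorb the small primes and those dividing
   two coefficients; all the others contribute a factor [1 + O(p ^ (-3/2))]. *)
Lemma singular_series_ge : exists c K : nat, (0 < c)%N /\
  forall (a : {ffun 'I_s -> int}) (B : nat), (0 < B)%N -> (forall j, a j != 0) ->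
  (forall i j, i != j -> (gcdn `|a i| `|a j| <= B)%N) ->
  (forall j w, (w * w %| `|a j|)%N -> (w <= B)%N) ->
  0 < singular_series R k a ->
  ((c * B ^ K)%N%:R)^-1 <= singular_series R k a.
Proof.
pose C : R := (2 * k%:R ^+ 2) ^+ s + 1.
have C0 : 0 <= C by rewrite addr_ge0 // exprn_ge0 // mulr_ge0 // exprn_ge0.
(* Primes above [n0] are prime to [k], and the second entry gives the inequality [4 * C <= sqrt n0]
   of the tail product. *)
pose n0 := maxn k (Num.truncn ((4 * C) ^+ 2)).+1.
have n00 : (0 < n0)%N by rewrite leq_max k0.
have n0C : 4 * C <= Num.sqrt n0%:R.
  rewrite -[leLHS]ger0_norm ?mulr_ge0 // -sqrtr_sqr ler_sqrt //.
  apply: ltW; apply: lt_le_trans (truncnS_gt _) _.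
  by rewrite ler_nat leq_maxr.
(* The exponent of [B] in the bound for [Z N]: [s * s] from [M], and [s * s + 2] from [M * B ^ 2],
   raised to the power [s * 2]. *)
pose K1 := (s * s + (s * s + 2) * (s * 2))%N.
exists (2 * (n0`! * (k * n0`!) ^ (s * 2)) ^ s.-1)%N, (K1 * s.-1)%N.
split; first by rewrite muln_gt0 expn_gt0 muln_gt0 fact_gt0 expn_gt0 muln_gt0 k0 fact_gt0.
move=> a B B0 a0 gB wB S0.
have s0 : (0 < s)%N by apply: leq_trans s6.
have ch p : prime p -> 0 < chi R k a p by exact: chi_gt0.
set M := bad_modulus n0 a.
have M0 : (0 < M)%N by exact: bad_modulus_gt0.
set m := (\prod_j (k * `|a j|))%N.
have m0 : (0 < m)%N by apply: prodn_gt0 => j; rewrite muln_gt0 k0 absz_gt0 a0.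
have mpart : (m`_\pi(M) <= (k * (M * (B * B))) ^ s)%N.
  have -> : (m`_\pi(M) = \prod_j (k * `|a j|)`_\pi(M))%N.
    have [] // : (0 < m)%N /\ (m`_\pi(M) = \prod_j (k * `|a j|)`_\pi(M))%N.
    apply: (big_ind2 (fun x y => (0 < x)%N /\ (x`_\pi(M) = y)%N)).
    - by rewrite partn1.
    - by move=> x1 y1 x2 y2 [x10 <-] [x20 <-]; rewrite muln_gt0 x10 x20 partnM.
    - by move=> j _; rewrite muln_gt0 k0 absz_gt0 a0.
  apply: leq_trans (_ : \prod_(j < s) (k * (M * (B * B))) <= _)%N; last first.
    by rewrite prod_nat_const card_ord.
  apply: leq_prod => j _; rewrite partnM ?absz_gt0 //.
  apply: leq_mul; first by rewrite dvdn_leq // dvdn_part.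
  by apply: partn_le; rewrite ?absz_gt0 //; exact: wB.
have Mle : (M <= n0`! * B ^ (s * s))%N by exact: bad_modulus_le.
(* By [chi_ge_nonzero_coefs] the bad primes below [N] cost at most a factor [Z N ^ (s - 1)]. *)
pose Z N := (\prod_(0 <= p < N | prime p && (p \in \pi(M))) p ^ (2 * logn p m).+1)%N.
have Zle N : (Z N <= n0`! * (k * n0`!) ^ (s * 2) * B ^ K1)%N.
  have -> : Z N = ((\prod_(0 <= p < N | prime p && (p \in \pi(M))) p) *
     (\prod_(0 <= p < N | prime p && (p \in \pi(M))) p ^ logn p m) ^ 2)%N.
    rewrite expnS expn1 -!big_split /=; apply: eq_bigr => p _.
    by rewrite expnS mul2n -addnn expnD.
  have le2 : ((\prod_(0 <= p < N | prime p && (p \in \pi(M))) p ^ logn p m) ^ 2 <=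
      ((k * (M * (B * B))) ^ s) ^ 2)%N.
    by rewrite leq_exp2r // (leq_trans (prod_primes_logn_le _ _ m0)).
  apply: leq_trans (leq_mul (prod_primes_le N M0) le2) _.
  rewrite -expnM.
  apply: leq_trans (_ : n0`! * B ^ (s * s) *
     (k * (n0`! * B ^ (s * s) * (B * B))) ^ (s * 2) <= _)%N.
    apply: leq_mul => //; rewrite leq_exp2r ?muln_gt0 ?s0 //.
    by rewrite leq_mul2l leq_mul2r Mle !orbT.
  have -> : (B ^ K1 = B ^ (s * s) * (B ^ (s * s) * (B * B)) ^ (s * 2))%N.
    by rewrite /K1 expnD (expnM B (s * s + 2)) expnD.
  rewrite eq_leq //; move: (B ^ (s * s))%N (s * 2)%N => b e.
  by rewrite !expnMn; ring.
apply: (cvgr_to_ge (singular_series_cvg S0)); near=> N.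
rewrite (bigID (fun p => p \in \pi(M))) /=.
have tail : 1 / 2 <= \prod_(0 <= p < N | prime p && (p \notin \pi(M))) chi R k a p.
  apply: (tail_prod_ge_half C0 n00 n0C) => p /andP[pp pM].
  have [n0p pij] := good_prime pp a0 pM; split => //.
  apply: chi_ge_coprime_coefs => //; last exact: ch.
  by rewrite gtnNdvd // (leq_ltn_trans _ n0p) // leq_maxl.
have head : ((Z N ^ s.-1)%N%:R)^-1 <=
    \prod_(0 <= p < N | prime p && (p \in \pi(M))) chi R k a p.
  have -> : ((Z N ^ s.-1)%N%:R)^-1 = \prod_(0 <= p < N | prime p && (p \in \pi(M)))
      ((p%:R ^+ ((2 * logn p m).+1 * s.-1))^-1) :> R.
    rewrite /Z natrX natr_prod -prodrXl -prodfV; apply: eq_bigr => p _.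
    by rewrite natrX -exprM.
  apply: ler_prod => p /andP[pp _]; rewrite invr_ge0 exprn_ge0 //=.
  by apply: chi_ge_nonzero_coefs => //; [rewrite k0 | exact: ch].
have h1 : 0 <= ((Z N ^ s.-1)%N%:R)^-1 :> R by rewrite invr_ge0.
have h2 : 0 <= 1 / 2 :> R by rewrite divr_ge0.
apply: le_trans (ler_pM h1 h2 head tail).
have Z0 : (0 < Z N)%N.
  rewrite /Z big_seq_cond; apply: prodn_cond_gt0 => p /andP[_ /andP[pp _]].
  by rewrite expn_gt0 prime_gt0.
rewrite mul1r -invfM -natrM lef_pV2 ?posrE ?ltr0n ?ler_nat.
- rewrite mulnC (expnM B) -mulnA -expnMn leq_mul2l /= leq_exp2r //.
  by rewrite -ltnS prednK // (leq_trans _ s6).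
- by rewrite !muln_gt0 !expn_gt0 muln_gt0 fact_gt0 expn_gt0 muln_gt0 k0 fact_gt0 B0.
- by rewrite muln_gt0 expn_gt0 Z0.
Unshelve. all: by end_near. Qed.
End LowerBound.

(** * Counting coefficient vectors with large common or square divisors *)

Section Counting.
Variables (s N : nat).

(* Nonzero integers of absolute value at most [N], as a sign and a predecessor. *)
Local Notation box := {ffun 'I_s -> bool * 'I_N}.

Definition box_int (b : box) : {ffun 'I_s -> int} :=
  [ffun j => (-1) ^+ (b j).1 * (b j).2.+1%:Z].

Lemma absz_box_int (b : box) j : `|box_int b j|%N = (b j).2.+1.
Proof. by rewrite ffunE abszMsign. Qed.

Lemma box_int_surj (a : {ffun 'I_s -> int}) :
  (forall j, (0 < `|a j| <= N)%N) -> exists b, box_int b = a.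
Proof.
move=> aN.
have lt j : (`|a j|.-1 < N)%N by have /andP[a0 ale] := aN j; rewrite prednK.
exists [ffun j => (a j < 0, Ordinal (lt j))]; apply/ffunP => j; rewrite !ffunE /=.
by have /andP[a0 _] := aN j; rewrite prednK // -intEsign.
Qed.

Lemma card_multiples (e : nat) :
  (#|[set y : bool * 'I_N | (e %| y.2.+1)%N]| * e <= 2 * N)%N.
Proof.
have -> : [set y : bool * 'I_N | (e %| y.2.+1)%N] =
    finset.setX [set: bool] [set m : 'I_N | (e %| m.+1)%N].
  by apply/setP => -[x m]; rewrite finset.in_setX !inE.
rewrite cardsX cardsT card_bool -mulnA leq_mul2l /=.
have -> : #|[set m : 'I_N | (e %| m.+1)%N]| = (N %/ e)%N.
  rewrite divn_count_dvd big_add1 /= big_mkord -sum1_card big_mkcond /=.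
  by apply: eq_bigr => m _; rewrite inE; case: (_ %| _)%N.
by rewrite leq_trunc_div.
Qed.

(** For [i = j] the modulus at that coordinate is [d * d], so common divisors of two coefficients
    and square divisors of one are treated together. *)
Definition pair_modulus (i j : 'I_s) (d : nat) (l : 'I_s) : nat :=
  ((if l == i then d else 1) * (if l == j then d else 1))%N.

Lemma card_pair_divisible (i j : 'I_s) (d : nat) :
  (#|[set b : box | [forall l, pair_modulus i j d l %| (b l).2.+1]]| * (d * d)
   <= (2 * N) ^ s)%N.
Proof.
have -> : [set b : box | [forall l, (pair_modulus i j d l %| (b l).2.+1)%N]] =
   [set b in family (fun l => mem [set y : bool * 'I_N |
                                  (pair_modulus i j d l %| y.2.+1)%N])].
  apply/setP => b; rewrite !inE; apply/forallP/familyP => H l; have := H l;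
    by rewrite !inE.
have prod_if (l0 : 'I_s) : (\prod_(l < s) (if l == l0 then d else 1) = d)%N.
  by rewrite -big_mkcond big_pred1_eq.
have -> : (d * d = \prod_(l < s) pair_modulus i j d l)%N.
  by rewrite big_split /= !prod_if.
rewrite cardsE card_family foldrE big_map big_enum /= -big_split /=.
apply: leq_trans (_ : \prod_(l < s) (2 * N) <= _)%N; last first.
  by rewrite prod_nat_const card_ord.
by apply: leq_prod => l _; exact: card_multiples.
Qed.

(** Taking [d <= N] suffices: a common divisor, or the root of a square divisor, is at most a
    coefficient in absolute value. *)
Definition unbalanced (B : nat) : {set box} :=
  \bigcup_(ijd : 'I_s * 'I_s * 'I_N.+1 | (B < ijd.2)%N)
     [set b : box | [forall l, (pair_modulus ijd.1.1 ijd.1.2 ijd.2 l %| (b l).2.+1)%N]].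

Lemma unbalanced_gcd (B : nat) (b : box) i j : b \notin unbalanced B -> i != j ->
  (gcdn `|box_int b i| `|box_int b j| <= B)%N.
Proof.
move=> nb ij; rewrite leqNgt; apply: contra nb => gB.
have gN : (gcdn `|box_int b i| `|box_int b j| < N.+1)%N.
  rewrite ltnS; apply: leq_trans (dvdn_leq _ (dvdn_gcdl _ _)) _;
    by rewrite absz_box_int.
apply/bigcupP; exists (i, j, Ordinal gN) => //; rewrite inE; apply/forallP => l.
rewrite /pair_modulus /= -absz_box_int.
case: (eqVneq l i) => [->|_]; last first.
  by case: eqP => [->|_]; rewrite mul1n ?dvdn_gcdr.
by rewrite (negbTE ij) muln1 dvdn_gcdl.
Qed.

Lemma unbalanced_square (B : nat) (b : box) j w : b \notin unbalanced B ->
  (w * w %| `|box_int b j|)%N -> (w <= B)%N.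
Proof.
move=> nb ww; rewrite leqNgt; apply: contra nb => wB.
have wN : (w < N.+1)%N.
  rewrite ltnS; apply: leq_trans (_ : w * w <= _)%N.
    by rewrite leq_pmull // (leq_ltn_trans _ wB).
  by apply: leq_trans (dvdn_leq _ ww) _; rewrite absz_box_int.
apply/bigcupP; exists (j, j, Ordinal wN) => //; rewrite inE; apply/forallP => l.
by rewrite /pair_modulus /= -absz_box_int; case: eqP => [->|].
Qed.

Lemma sum_inv_sqr_le (R : realType) (B n : nat) : (0 < B)%N ->
  \sum_(d < n | (B < d)%N) (d * d)%N%:R^-1 <= B%:R^-1 :> R.
Proof.
move=> B0.
(* Telescoping through [1 / d ^ 2 <= 1 / (d - 1) - 1 / d]; the [maxn] makes the right side zero
   while the sum is empty. *)
suff : \sum_(d < n | (B < d)%N) (d * d)%N%:R^-1 <= B%:R^-1 - (maxn B n.-1)%:R^-1 :> R.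
  by move/le_trans; apply; rewrite gerBl invr_ge0.
elim: n => [|n IH]; first by rewrite big_ord0 maxn0 subrr.
rewrite big_mkcond big_ord_recr -big_mkcond /=.
case: ifP => Bn; last first.
  rewrite addr0; apply: le_trans IH _; rewrite lerD2l lerN2.
  rewrite lef_pV2 ?posrE ?ltr0n ?leq_max ?B0 // ler_nat.
  by rewrite geq_max leq_maxl leq_max leq_pred orbT.
have n0 : (0 < n)%N by apply: leq_trans Bn.
have E : maxn B n.-1 = n.-1 by apply/maxn_idPr; rewrite -ltnS prednK.
rewrite (maxn_idPr (ltnW Bn)); rewrite E in IH.
have m0 : 0 < n.-1%:R :> R by rewrite ltr0n (leq_trans B0) // -E leq_maxl.
have nE : n%:R = n.-1%:R + 1 :> R by rewrite natr1 prednK.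
suff : (n * n)%N%:R^-1 <= n.-1%:R^-1 - n%:R^-1 :> R by move: IH; lra.
rewrite natrM nE; move: (n.-1%:R : R) m0 => x x0.
have -> : x^-1 - (x + 1)^-1 = (x * (x + 1))^-1.
  by field; rewrite !gt_eqF //; lra.
by rewrite lef_pV2 ?posrE ?mulr_gt0 //; nra.
Qed.

Lemma card_unbalanced (R : realType) (B : nat) : (0 < B)%N ->
  #|unbalanced B|%:R <= (s * s)%N%:R * (2 * N%:R) ^+ s / B%:R :> R.
Proof.
move=> B0.
have le1 : (#|unbalanced B| <= \sum_(ijd : 'I_s * 'I_s * 'I_N.+1 | (B < ijd.2)%N)
   #|[set b : box | [forall l, (pair_modulus ijd.1.1 ijd.1.2 ijd.2 l %| (b l).2.+1)%N]]|)%N.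
  apply: (big_ind2 (fun (X : {set box}) n => (#|X| <= n)%N)) => //.
    by rewrite cards0.
  move=> X1 n1 X2 n2 h1 h2; apply: leq_trans (leq_card_setU _ _) (leq_add h1 h2).
have : #|unbalanced B|%:R <= \sum_(ijd : 'I_s * 'I_s * 'I_N.+1 | (B < ijd.2)%N)
     (2 * N%:R) ^+ s * (ijd.2 * ijd.2)%N%:R^-1 :> R.
  apply: le_trans (_ : _ <= _%:R) _; first by rewrite ler_nat; exact: le1.
  rewrite natr_sum; apply: ler_sum => -[[i j] d] /= Bd.
  have d0 : (0 < d)%N by apply: leq_trans Bd.
  rewrite ler_pdivlMr ?ltr0n ?muln_gt0 ?d0 // -[2]/(2%:R) -natrM -natrX -natrM ler_nat.
  exact: card_pair_divisible.
move/le_trans; apply.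
rewrite -mulr_sumr -(pair_big_dep predT (fun _ (d : 'I_N.+1) => (B < d)%N)
  (fun _ (d : 'I_N.+1) => (d * d)%N%:R^-1)) /=.
rewrite sumr_const card_prod !card_ord -[_ *+ (s * s)]mulr_natl mulrCA -mulrA.
rewrite ler_wpM2l // ler_wpM2l ?exprn_ge0 ?mulr_ge0 //.
exact: sum_inv_sqr_le.
Qed.

End Counting.

(** * Choice of [B] as a power of [A], and the final count *)

Lemma card_fset_set_le (T : finType) (U : choiceType) (E : {set T}) (f : T -> U)
    (X : set U) : finite_set X ->
  (forall x, X x -> exists2 y, y \in E & f y = x) -> (#|` fset_set X| <= #|E|)%N.
Proof.
move=> finX XE; rewrite cardE -(size_map f (enum E)).
apply: uniq_leq_size; first exact: fset_uniq.
move=> x; rewrite in_fset_set // => /set_mem /XE[y yE <-].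
by apply: map_f; rewrite mem_enum.
Qed.

Theorem theorem1p2 (R : realType) (k s : nat) (eta : R)
    (hk : (3 <= k)%N) (hs : (k + 3 <= s)%N) (heta : 0 < eta) :
  exists gamma : R, 0 < gamma /\
    exists C : R, forall A : R, 1 <= A ->
      #|` fset_set (@exceptional_set R k s eta A)|%:R
        <= C * A `^ (s%:R - gamma).
Proof.
have k0 : (0 < k)%N by apply: leq_trans hk.
have ks : (k < s)%N by apply: leq_trans hs; rewrite addn3 ltnS leqW.
have s6 : (6 <= s)%N by apply: leq_trans hs; rewrite -[6%N]/(3 + 3)%N leq_add2r.
have [c [K [c0 lower]]] := singular_series_ge R k0 ks s6.
(* With [B] about [A ^ eps], this makes [B ^ K] at most [A ^ (eta / 2)]. *)
pose eps : R := eta / (2 * K.+1%:R).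
have K0 : 0 < K.+1%:R :> R by rewrite ltr0n.
have eps0 : 0 < eps by rewrite divr_gt0 // mulr_gt0.
have epsK : eps * K%:R <= eta / 2.
  have e2 : 0 <= eta / 2 by rewrite divr_ge0 // ltW.
  have KK : K.+1%:R^-1 * K%:R <= 1 :> R by rewrite mulrC ler_pdivrMr // mul1r ler_nat.
  by rewrite /eps invfM mulrA -mulrA ler_piMr.
(* For [A >= A0] the constant [c] is at most [A ^ (eta / 2)]. *)
pose A0 : R := c%:R `^ (2 / eta).
exists eps; split => //.
(* The first term bounds the unbalanced vectors, with a factor 2 for rounding [A ^ eps] down to [B];
   the second covers [A < A0] trivially, since then [A ^ eps <= A0 ^ eps]. *)
exists ((s * s)%N%:R * 2 ^+ s * 2 + 2 ^+ s * A0 `^ eps) => A A1.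
have A_gt0 : 0 < A by apply: lt_le_trans A1.
have An0 : A != 0 by rewrite gt_eqF.
have A_ge0 : 0 <= A := ltW A_gt0.
have AE : A `^ (s%:R - eps) = A ^+ s / A `^ eps.
  by rewrite powRB ?An0 ?implybT // powR_mulrn.
pose N := Num.truncn A.
have NA : N%:R <= A by rewrite truncn_le.
have Aeps : 1 <= A `^ eps by rewrite -(powRr0 A) ler_powR // ltW.
have Aeps0 : 0 < A `^ eps by rewrite powR_gt0.
have pw : (2 * N%:R) ^+ s <= 2 ^+ s * A ^+ s :> R.
  by rewrite -exprMn; apply: lerXn2r; rewrite ?nnegrE ?mulr_ge0 // ler_wpM2l.
have box_of a : exceptional_set k eta A a ->
    exists b : {ffun 'I_s -> bool * 'I_N}, box_int b = a.
  move=> [a0 aA _]; apply: box_int_surj => j; rewrite absz_gt0 a0 /=.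
  rewrite truncn_ge_nat //; apply: le_trans aA.
  rewrite /supnorm (bigD1 j) //= le_max -intr_norm -abszE -pmulrn lexx //.
have fin := @finite_exceptional_set R k s eta A.
have two0 : 0 <= (2 : R) ^+ s by rewrite exprn_ge0.
have [AA0|AA0] := ltP A A0.
  have : (#|` fset_set (@exceptional_set R k s eta A)| <= (2 * N) ^ s)%N.
    apply: leq_trans (card_fset_set_le (E := [set: {ffun 'I_s -> bool * 'I_N}])
       (f := @box_int s N) fin _) _.
      by move=> a /box_of[b ba]; exists b.
    by rewrite cardsT card_ffun card_prod card_bool !card_ord.
  rewrite -(ler_nat R) natrX natrM => /le_trans; apply.
  apply: le_trans pw _.
  rewrite AE mulrDl -[leLHS]add0r lerD //.
    by rewrite !mulr_ge0 // ?exprn_ge0 ?invr_ge0 ?powR_ge0 // ltW.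
  have r1 : 1 <= A0 `^ eps / A `^ eps.
    rewrite ler_pdivlMr // mul1r; apply: ge0_ler_powR; rewrite ?nnegrE ?powR_ge0 //;
      exact: ltW.
  by rewrite -mulrA ler_wpM2l // mulrCA ler_peMr // exprn_ge0.
pose B := Num.truncn (A `^ eps).
have B0 : (0 < B)%N by rewrite truncn_gt0.
have BA : B%:R <= A `^ eps by rewrite truncn_le // ltW.
have AB : A `^ eps <= 2 * B%:R.
  apply: le_trans (ltW (truncnS_gt _)) _; rewrite -/B -[2]/(2%:R) -natrM ler_nat.
  by rewrite mul2n -addnn -addn1 leq_add2l.
have : (#|` fset_set (@exceptional_set R k s eta A)| <= #|unbalanced s N B|)%N.
  apply: (card_fset_set_le (f := @box_int s N) fin) => a aX.
  have [b ba] := box_of a aX; exists b => //.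
  (* Outside [unbalanced] the singular series is at least [1 / (c * B ^ K) >= A ^ (-eta)], against
     its assumed smallness. *)
  apply/negPn/negP => nb.
  have [a0 _ /andP[S0 S1]] := aX.
  have : ((c * B ^ K)%N%:R)^-1 <= singular_series R k a.
    apply: lower => // [i j ij|j w]; rewrite -ba; first exact: unbalanced_gcd.
    exact: unbalanced_square.
  rewrite leNgt => /negP; apply; apply: lt_le_trans S1 _.
  have half : c%:R <= A `^ (eta / 2).
    have -> : c%:R = A0 `^ (eta / 2).
      rewrite /A0 -powRrM.
      have -> : 2 / eta * (eta / 2) = 1 by field; rewrite gt_eqF.
      by rewrite powRr1.
    by apply: ge0_ler_powR; rewrite ?nnegrE ?powR_ge0 ?divr_ge0 // ltW.
  have BK : B%:R ^+ K <= A `^ (eta / 2).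
    apply: le_trans (_ : (A `^ eps) ^+ K <= _).
      by apply: lerXn2r; rewrite ?nnegrE // ltW.
    by rewrite -powR_mulrn ?powR_ge0 // -powRrM ler_powR.
  rewrite powRN lef_pV2 ?posrE ?powR_gt0 // ?ltr0n ?muln_gt0 ?c0 ?expn_gt0 ?B0 //.
  have -> : A `^ eta = A `^ (eta / 2) * A `^ (eta / 2).
    by rewrite -powRD ?An0 ?implybT // -splitr.
  by rewrite natrM natrX ler_pM.
rewrite -(ler_nat R) => cardle.
apply: le_trans cardle (le_trans (card_unbalanced s N R B0) _).
rewrite AE [leRHS]mulrDl; apply: ler_wpDr.
  by rewrite !mulr_ge0 // ?exprn_ge0 ?invr_ge0 ?powR_ge0 // ltW.
have -> : (s * s)%N%:R * 2 ^+ s * 2 * (A ^+ s / A `^ eps) =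
    (s * s)%N%:R * (2 ^+ s * A ^+ s) * (2 / A `^ eps) by ring.
apply: ler_pM; rewrite ?mulr_ge0 ?exprn_ge0 ?invr_ge0 //.
  by rewrite ler_wpM2l.
by rewrite ler_pdivlMr // mulrC ler_pdivrMr ?ltr0n.
Qed.
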